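(* Let $P^{\mathrm{obs}}$ be the law of $W=(Y,X)$ with compact support $\mathcal W$, and let $\theta=(b_0,b_1,r)\in\mathbb R^k\times\mathbb R^k\times(0,\infty)$. With $\Theta_I^{0,\tau}$, $\mathcal X$, $K_\theta$ and $\Psi_\theta^{0,\tau}$ as defined in the context, $$\theta\in\Theta_I^{0,\tau}\quad\Longleftrightarrow\quad\Psi_\theta^{0,\tau}(\lambda)\ge0\ \text{ for every }\lambda\in C_+(\mathcal X\times K_\theta)^{4T}.$$ If $\theta\notin\Theta_I^{0,\tau}$, there is $\lambda\in C_+(\mathcal X\times K_\theta)^{4T}$ with $\Psi_\theta^{0,\tau}(\lambda)<0$. Consequently, the projected set $\Theta_{I,\tau}^{\mathrm{pt}}=\{(b_1,r):\exists\,b_0\in\mathcal B_0\text{ with }(b_0,b_1,r)\in\Theta_I^{0,\tau}\}$ equals the set of $(b_1,r)$, $r>0$, for which there is $b_0\in\mathcal B_0$ such that $\theta=(b_0,b_1,r)$ satisfies $\Psi_\theta^{0,\tau}(\lambda)\ge0$ for every $\lambda\in C_+(\mathcal X\times K_\theta)^{4T}$.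
   Context: $T,k\ge1$ are integers, $\tau\in(0,1)$, $\tau\ne1/2$, $q_0=1/2$, $q_1=\tau$, $\mathcal B_0\subseteq\mathbb R^k$. $Y\in\mathbb R^T$, $X=(X_1,\dots,X_T)$, $X_t\in\mathbb R^k$. For $w=(y,x)$ let $Z_{0t}(\theta;w)=y_t-x_t'b_0$ and $Z_{1t}(\theta;w)=(y_t-x_t'b_1)/r$; write $Z_{\ell t}(\theta)=Z_{\ell t}(\theta;W)$. $\Theta_I^{0,\tau}$ is the set of $\theta=(b_0,b_1,r)$ with $r>0$ for which there is a Borel probability law $\pi$ of $(Y,X,A)$, $A\in\mathbb R$, with $(Y,X)$-marginal $P^{\mathrm{obs}}$, such that $\pi$-a.s., for $\ell=0,1$ and all $t\le T$, $\pi\{Z_{\ell t}(\theta)\le A\mid X,A\}\ge q_\ell$ and $\pi\{Z_{\ell t}(\theta)<A\mid X,A\}\le q_\ell$. $\mathcal X$ is the projection of $\mathcal W$ onto the support of $X$. $K_\theta=[\underline z_\theta,\overline z_\theta]$, where $\underline z_\theta$ and $\overline z_\theta$ are the minimum and maximum of $Z_{\ell t}(\theta;w)$ over $w\in\mathcal W$, $\ell\in\{0,1\}$, $t\le T$. $C_+$ denotes nonnegative continuous functions. For $\lambda=\{\lambda_{\ell t}^-,\lambda_{\ell t}^+\}_{\ell=0,1;\,t\le T}$, $$S_\theta(w,a;\lambda)=\sum_{\ell=0}^1\sum_{t=1}^T\Big[\lambda_{\ell t}^-(x,a)\{\mathbf 1(Z_{\ell t}(\theta;w)\le a)-q_\ell\}+\lambda_{\ell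 t}^+(x,a)\{q_\ell-\mathbf 1(Z_{\ell t}(\theta;w)<a)\}\Big],$$ $$\Psi_\theta^{0,\tau}(\lambda)=E_{P^{\mathrm{obs}}}\big[\max_{a\in K_\theta}S_\theta(W,a;\lambda)\big].$$ *)

(* Defs.v *)
From HB Require Import structures.
From mathcomp Require Import all_boot all_order all_algebra.
From mathcomp Require Import all_classical all_reals all_analysis.
Set Implicit Arguments.
Unset Strict Implicit.
Unset Printing Implicit Defensive.
Import Order.TTheory GRing.Theory Num.Theory.
Import numFieldNormedType.Exports.
Local Open Scope classical_set_scope.
Local Open Scope ring_scope.

(* [V] with the Borel sigma-algebra of its topology. *)
Notation borel V := (g_sigma_algebraType (@open V)).

Definition msupport (R : realType) (V : topologicalType)
    (P : set V -> \bar R) : set V :=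
  [set v | forall U : set V, open U -> U v -> (0 < P U)%E].

(* [g] is a version of the conditional probability of [E] given the random
   variable [V]: [g] is sigma(V)-measurable, and its integral over every [G] in
   sigma(V) is mu (E `&` G). *)
Definition is_cond_prob (R : realType) (d d' : measure_display)
    (O : measurableType d) (O' : measurableType d') (mu : probability O R)
    (V : O -> O') (E : set O) (g : O -> R) : Prop :=
  [/\ measurable_fun [set: g_sigma_algebra_preimageType V] g,
      mu.-integrable setT (EFin \o g)
    & forall G : set O, g_sigma_algebra_preimage V G ->
        (\int[mu]_(o in G) (g o)%:E = mu (E `&` G))%E].

Definition cont_nonneg (R : realType) (V : topologicalType) (D : set V)
    (f : V -> R) : Prop :=
  {within D, continuous f} /\ (forall v, D v -> 0 <= f v).

Section model.
Context (R : realType) (T k : nat).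

(* w = (y, x); row t of x is x_t' *)
Definition obs := ('cV[R]_T * 'M[R]_(T, k))%type.
(* (w, a) and (x, a) *)
Definition obsA := (obs * R)%type.
Definition covA := ('M[R]_(T, k) * R)%type.
(* theta = (b0, b1, r) *)
Definition param := ('cV[R]_k * 'cV[R]_k * R)%type.

Definition q (tau : R) (l : 'I_2) : R := if l == ord0 then 1 / 2 else tau.

Definition Z (th : param) (l : 'I_2) (t : 'I_T) (w : obs) : R :=
  let: (b0, b1, r) := th in
  if l == ord0 then w.1 t ord0 - (row t w.2 *m b0) ord0 ord0
  else (w.1 t ord0 - (row t w.2 *m b1) ord0 ord0) / r.

(* (y, x, a) |-> (x, a) *)
Definition covlat (o : borel obsA) : borel covA :=
  (o.1.2, o.2).

Definition Theta_I (tau : R) (P : probability (borel obs) R) : set param :=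
  [set th | 0 < th.2 /\
    exists pi : probability (borel obsA) R,
    [/\ (forall B : set (borel obs), measurable B ->
           pushforward pi (fst : borel obsA -> borel obs) B = P B)
      & exists p_le p_lt : 'I_2 -> 'I_T -> borel obsA -> R,
        [/\ forall l t, is_cond_prob pi covlat
              [set o | Z th l t o.1 <= o.2] (p_le l t),
            forall l t, is_cond_prob pi covlat
              [set o | Z th l t o.1 < o.2] (p_lt l t)
          & {ae pi, forall o, forall l t,
               q tau l <= p_le l t o /\ p_lt l t o <= q tau l}]]].

Definition Theta_pt (tau : R) (B0 : set 'cV[R]_k)
    (P : probability (borel obs) R) : set ('cV[R]_k * R) :=
  [set p | exists2 b0, B0 b0 & Theta_I tau P (b0, p.1, p.2)].

Definition X_supp (P : probability (borel obs) R) : set 'M[R]_(T, k) :=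
  snd @` msupport P.

Definition Z_values (th : param) (P : probability (borel obs) R) : set R :=
  [set z | exists l t w, msupport P w /\ z = Z th l t w].

(* When the support is compact, this inf and this sup are attained, since [Z] is
   continuous in w. *)
Definition K_theta (th : param) (P : probability (borel obs) R) : set R :=
  `[inf (Z_values th P), sup (Z_values th P)]%classic.

Record multiplier := Multiplier {
  lam_minus : 'I_2 -> 'I_T -> covA -> R ;
  lam_plus : 'I_2 -> 'I_T -> covA -> R }.

(* The multipliers are total functions, but only their values on X_supp P `*` K_theta
   matter in [Psi]. *)
Definition admissible (th : param) (P : probability (borel obs) R)
    (lam : multiplier) : Prop :=
  forall l t, cont_nonneg (X_supp P `*` K_theta th P) (lam_minus lam l t) /\
              cont_nonneg (X_supp P `*` K_theta th P) (lam_plus lam l t).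

Definition S_theta (tau : R) (th : param) (lam : multiplier) (w : obs) (a : R) : R :=
  \sum_(l < 2) \sum_(t < T)
    (lam_minus lam l t (w.2, a) * ((Z th l t w <= a)%R%:R - q tau l) +
     lam_plus lam l t (w.2, a) * (q tau l - (Z th l t w < a)%R%:R)).

(* The sup is a max: for admissible [lam], [S_theta] is upper semicontinuous in a on
   the compact interval [K_theta]. The integrand is only meaningful on the support of P,
   a set of full measure, hence the integration domain. *)
Definition Psi (tau : R) (P : probability (borel obs) R) (th : param)
    (lam : multiplier) : \bar R :=
  (\int[P]_(w in msupport P)
     (sup [set S_theta tau th lam w a | a in K_theta th P])%:E)%E.

End model.

(* Main.v *)
(* Only the first marginal of the sought law of (W, A) is prescribed, and K_theta
   is one-dimensional; this replaces weak compactness and Riesz representation.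

   Necessity. Under a law that satisfies the quantile restrictions, A > max K_theta
   would give P(Z < A | X, A) = 1 > q, and A < min K_theta would give
   P(Z <= A | X, A) = 0 < q, so A lies in K_theta and the integrand max_a S_theta(W, a)
   of Psi dominates S_theta(W, A), whose mean is nonnegative.

   Sufficiency. On bounded functions of (w, a) let p(f) be the upper integral of
   sup_{a in K_theta} f(w, a); it is sublinear, and Psi >= 0 says that p >= 0 on the
   convex cone of the functions S_theta(., .; lam). By Hahn-Banach a linear L <= p is
   nonnegative on that cone. It is a finitely additive law of (W, A) whose
   W-marginal is P, so for each c the set function B |-> L(1_B(w) 1(c < a)) is
   dominated by P, hence countably additive, with a density G_c. The G_c are the
   survival functions of a kernel, which the quantile transform turns into a genuine
   law pi; pi and L agree on functions that are Lipschitz in a. Continuous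
   approximations from above of the indicators of {Z <= A} and of closed events in
   (X, A), and inner regularity by closed sets, then give the conditional bounds. *)

Require Import Defs.
From HB Require Import structures.
From mathcomp Require Import all_boot all_order all_algebra.
From mathcomp Require Import all_classical all_reals all_analysis.
From mathcomp Require Import measurable_realfun ring lra.
Import Order.TTheory GRing.Theory Num.Theory.
Import numFieldNormedType.Exports.
Local Open Scope classical_set_scope.
Local Open Scope ring_scope.
Set Implicit Arguments.
Unset Strict Implicit.
Unset Printing Implicit Defensive.

(** * A Hahn-Banach theorem *)

(** A finitely additive [L] may put mass infinitely close above a level c, so L(1(c < a)) need not
    be right-continuous in c, and a countably additive law cannot always reproduce [L] on such
    indicators. The law read off from the densities satisfies only a sandwich: its mass above c lies
    between the values of [L] at c' and at c, for every c' > c. For functions Lipschitz in a this is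
    enough. Along a grid of mesh eta each gap is multiplied by an increment of order C eta, and the
    gaps telescope to at most 1, so the error vanishes with eta. Hence the indicators in [S_theta]
    must become Lipschitz ramps before [L] is exchanged for the law, and this replacement must
    increase the function, because monotonicity of [L] is what carries the sign over. A second
    obstacle is that each density is determined only up to a null set depending on its level.
    Restricting the quantile transform to rational levels leaves countably many exceptional sets. *)

Definition sublinear_on (R : realType) (V : lmodType R) (D : set V) (p : V -> R) :=
  (forall x y, D x -> D y -> p (x + y) <= p x + p y) /\
  (forall a x, 0 <= a -> D x -> p (a *: x) <= a * p x).

Section sublinear.
Context (R : realType) (V : lmodType R) (D : set V).
Hypotheses (D0 : D 0) (DD : forall x y, D x -> D y -> D (x + y)).
Hypothesis DZ : forall (a : R) x, D x -> D (a *: x).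

Lemma sublinear_ge0 (p : V -> R) x : sublinear_on D p -> D x -> 0 <= p x + p (- x).
Proof.
move=> [pD _] Dx.
have := pD 0 0 D0 D0; rewrite addr0 => p0.
have DNx : D (- x) by rewrite -scaleN1r; exact: DZ.
have := pD x (- x) Dx DNx; rewrite subrr; lra.
Qed.

Lemma sublinear0 (p : V -> R) : sublinear_on D p -> p 0 = 0.
Proof.
move=> sp; have := sublinear_ge0 sp D0; rewrite oppr0.
have := sp.2 0 0 (lexx _) D0; rewrite scale0r mul0r; lra.
Qed.

Lemma sublinearZ (p : V -> R) a x : sublinear_on D p -> 0 <= a -> D x ->
  p (a *: x) = a * p x.
Proof.
move=> sp; rewrite le_eqVlt => /orP[/eqP <-|a0] Dx.
  by rewrite scale0r mul0r sublinear0.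
apply/eqP; rewrite eq_le sp.2 ?(ltW a0)//=.
rewrite mulrC -ler_pdivlMr// mulrC.
have := sp.2 a^-1 (a *: x); rewrite invr_ge0 scalerA mulVf ?gt_eqF// scale1r.
by apply; [exact: ltW|exact: DZ].
Qed.

(** Supplies the bound of a chain for Zorn's lemma. The infimum is finite because a sublinear q
    below p satisfies q x >= - p (- x). It is subadditive because, of two members chosen separately
    at x and at y, the smaller one serves both points. *)
Lemma sublinear_inf_chain (p : V -> R) (A : set (V -> R)) :
  A !=set0 ->
  (forall q, A q -> sublinear_on D q /\ forall x, D x -> q x <= p x) ->
  (forall q r, A q -> A r -> (forall x, D x -> q x <= r x) \/
                            (forall x, D x -> r x <= q x)) ->
  let m x := inf [set q x | q in A] in
  [/\ sublinear_on D m, forall x, D x -> m x <= p x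
    & forall q x, A q -> D x -> m x <= q x].
Proof.
move=> [q0 Aq0] Ap Atot m.
have DN x : D x -> D (- x) by move=> Dx; rewrite -scaleN1r; exact: DZ.
have mle q x : A q -> D x -> m x <= q x.
  move=> Aq Dx; apply: ge_inf; last by exists q.
  exists (- p (- x)) => _ [r Ar <-].
  have [sr rp] := Ap _ Ar; have := sublinear_ge0 sr Dx; have := rp _ (DN _ Dx).
  lra.
have lem x y : (forall q, A q -> y <= q x) -> y <= m x.
  move=> h; apply: lb_le_inf; first by exists (q0 x), q0.
  by move=> _ [q Aq <-]; exact: h.
split=> //.
- split=> [x y Dx Dy|a x a0 Dx].
    rewrite -lerBlDr; apply: (lem x) => q Aq; rewrite lerBlDr [_ + m y]addrC -lerBlDr.
    apply: (lem y) => r Ar; rewrite lerBlDr.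
    have [qr|rq] := Atot _ _ Aq Ar.
      apply: (le_trans (mle _ _ Aq (DD Dx Dy))).
      apply: (le_trans ((Ap _ Aq).1.1 _ _ Dx Dy)).
      by rewrite addrC lerD// qr.
    apply: (le_trans (mle _ _ Ar (DD Dx Dy))).
    apply: (le_trans ((Ap _ Ar).1.1 _ _ Dx Dy)).
    by rewrite addrC lerD// rq.
  have mq q : A q -> m (a *: x) <= a * q x.
    move=> Aq; apply: (le_trans (mle _ _ Aq (DZ a Dx))).
    exact: (Ap _ Aq).1.2.
  move: a0; rewrite le_eqVlt => /orP[/eqP a0|a0].
    by rewrite -a0 mul0r; have := mq _ Aq0; rewrite -a0 mul0r.
  by rewrite -ler_pdivrMl//; apply: lem => q Aq; rewrite ler_pdivrMl//; exact: mq.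
- by move=> x Dx; apply: (le_trans (mle _ _ Aq0 Dx)); exact: (Ap _ Aq0).2.
Qed.

(** The witness is the infimum over t >= 0 of q (x + t y) - t q y. Taking t = 0 bounds it by q x;
    taking t = 1 at - y bounds it by q 0 - q y = - q y. *)
Lemma sublinear_shift (q : V -> R) y : sublinear_on D q -> D y ->
  exists r, [/\ sublinear_on D r, forall x, D x -> r x <= q x
              & r (- y) <= - q y].
Proof.
move=> sq Dy.
have DN x : D x -> D (- x) by move=> Dx; rewrite -scaleN1r; exact: DZ.
pose m x := inf [set q (x + t *: y) - t * q y | t in [set t | 0 <= t]].
have mle t x : 0 <= t -> D x -> m x <= q (x + t *: y) - t * q y.
  move=> t0 Dx; apply: ge_inf; last by exists t.
  exists (- q (- x)) => _ [s /= s0 <-].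
  have := sq.1 (x + s *: y) (- x) (DD Dx (DZ s Dy)) (DN _ Dx).
  by rewrite addrC addKr sublinearZ//; lra.
have lem x z : (forall t, 0 <= t -> z <= q (x + t *: y) - t * q y) -> z <= m x.
  move=> h; apply: lb_le_inf; first by exists (q (x + 0 *: y) - 0 * q y), 0 => /=.
  by move=> _ [t t0 <-]; exact: h.
exists m; split.
- split=> [x z Dx Dz|a x a0 Dx].
    rewrite -lerBlDr; apply: (lem x) => s s0; rewrite lerBlDr [_ + m z]addrC -lerBlDr.
    apply: (lem z) => t t0; rewrite lerBlDr.
    apply: (le_trans (mle (s + t) _ (addr_ge0 s0 t0) (DD Dx Dz))).
    have := sq.1 (x + s *: y) (z + t *: y) (DD Dx (DZ s Dy)) (DD Dz (DZ t Dy)).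
    by rewrite addrACA -scalerDl; lra.
  have mt t : 0 <= t -> m (a *: x) <= a * (q (x + t *: y) - t * q y).
    move=> t0; apply: (le_trans (mle (a * t) _ (mulr_ge0 a0 t0) (DZ a Dx))).
    rewrite -scalerA -scalerDr sublinearZ//; last exact/DD/DZ.
    by rewrite mulrBr mulrA.
  move: a0; rewrite le_eqVlt => /orP[/eqP a0|a0].
    by rewrite -a0 mul0r; have := mt _ (lexx _); rewrite -a0 mul0r.
  by rewrite -ler_pdivrMl//; apply: lem => t t0; rewrite ler_pdivrMl//; exact: mt.
- by move=> x Dx; have := mle 0 x (lexx _) Dx; rewrite scale0r addr0 mul0r subr0.
- have := mle 1 (- y) ler01 (DN _ Dy).
  by rewrite scale1r addNr sublinear0// mul1r sub0r.
Qed.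

(* A minimal sublinear functional is linear: were [q] minimal with
   [q (- y) > - q y], [sublinear_shift] would give a strictly smaller one. *)
Theorem linear_minorant (p : V -> R) : sublinear_on D p ->
  exists L : V -> R,
    [/\ forall x y, D x -> D y -> L (x + y) = L x + L y,
        forall a x, D x -> L (a *: x) = a * L x
      & forall x, D x -> L x <= p x].
Proof.
move=> sp.
have DN x : D x -> D (- x) by move=> Dx; rewrite -scaleN1r; exact: DZ.
pose T := {q : V -> R | sublinear_on D q /\ forall x, D x -> q x <= p x}.
have p0 : T by exists p.
(* The order is reversed, so a maximal element for Zorn is a pointwise minimal functional. Values
   off [D] are not compared, which makes this a preorder only. *)
pose le (q r : T) := `[< forall x, D x -> sval r x <= sval q x >].
have [||A Atot|[q [sq qp]] qmin] := @ZL_preorder T p0 le.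
- by move=> t; apply/asboolP.
- move=> r s t /asboolP rs /asboolP st; apply/asboolP => x Dx.
  exact: le_trans (st _ Dx) (rs _ Dx).
- have [A0|A0] := pselect (A !=set0); last first.
    by exists p0 => s As; exfalso; apply: A0; exists s.
  have [|_ [q _ <-]|_ _ [q Aq <-] [r Ar <-]|] :=
    @sublinear_inf_chain p [set sval s | s in A].
  + by case: A0 => s As; exists (sval s), s.
  + exact: (svalP q).
  + by have [/asboolP|/asboolP] := Atot _ _ Aq Ar; [right|left].
  set m := fun x => inf _ => m1 m2 m3.
  exists (exist (fun q => sublinear_on D q /\ forall x, D x -> q x <= p x) m
    (conj m1 m2)) => s As; apply/asboolP => x Dx /=.
  by apply: m3 => //; exists s.
have qN y : D y -> q (- y) = - q y.
  move=> Dy; have [r [sr rq ry]] := sublinear_shift sq Dy.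
  have rp x : D x -> r x <= p x by move=> Dx; exact: le_trans (rq _ Dx) (qp _ Dx).
  have /asboolP := qmin (exist (fun q => sublinear_on D q /\
    forall x, D x -> q x <= p x) r (conj sr rp)) (introT (asboolP _) rq).
  move=> /(_ _ (DN _ Dy)) /= qr.
  by have := sublinear_ge0 sq Dy; lra.
exists q; split=> // [x y Dx Dy|a x Dx].
  have := sq.1 _ _ Dx Dy; have := sq.1 _ _ (DN _ Dx) (DN _ Dy).
  by rewrite -opprD !qN//; [lra|exact: DD].
have [a0|a0] := leP 0 a; first exact: sublinearZ.
rewrite -[a *: x]opprK -scaleNr qN; last exact: DZ.
by rewrite sublinearZ// ?mulNr ?opprK//; lra.
Qed.

(* Apply [linear_minorant] to [x |-> inf_(g in C) p (x + g)], which is at most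
   [p 0 = 0] at [- g]. *)
Theorem linear_minorant_cone (p : V -> R) (C : set V) : sublinear_on D p ->
  C `<=` D -> C 0 -> (forall g h, C g -> C h -> C (g + h)) ->
  (forall a g, 0 <= a -> C g -> C (a *: g)) -> (forall g, C g -> 0 <= p g) ->
  exists L : V -> R,
    [/\ forall x y, D x -> D y -> L (x + y) = L x + L y,
        forall a x, D x -> L (a *: x) = a * L x,
        forall x, D x -> L x <= p x
      & forall g, C g -> 0 <= L g].
Proof.
move=> sp CD C0 CA CZ Cp.
have DN x : D x -> D (- x) by move=> Dx; rewrite -scaleN1r; exact: DZ.
pose m x := inf [set p (x + g) | g in C].
have mle g x : C g -> D x -> m x <= p (x + g).
  move=> Cg Dx; apply: ge_inf; last by exists g.
  exists (- p (- x)) => _ [h Ch <-].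
  have := sp.1 (x + h) (- x) (DD Dx (CD _ Ch)) (DN _ Dx).
  by rewrite [x + h]addrC addrK; have := Cp _ Ch; lra.
have lem x z : (forall g, C g -> z <= p (x + g)) -> z <= m x.
  move=> h; apply: lb_le_inf; first by exists (p (x + 0)), 0.
  by move=> _ [g Cg <-]; exact: h.
have sm : sublinear_on D m.
  split=> [x y Dx Dy|a x a0 Dx].
    rewrite -lerBlDr; apply: (lem x) => g Cg; rewrite lerBlDr [_ + m y]addrC -lerBlDr.
    apply: (lem y) => h Ch; rewrite lerBlDr.
    apply: (le_trans (mle (g + h) _ (CA _ _ Cg Ch) (DD Dx Dy))).
    have := sp.1 (x + g) (y + h) (DD Dx (CD _ Cg)) (DD Dy (CD _ Ch)).
    by rewrite addrACA [p (y + h) + _]addrC.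
  have mt g : C g -> m (a *: x) <= a * p (x + g).
    move=> Cg; apply: (le_trans (mle (a *: g) _ (CZ _ _ a0 Cg) (DZ a Dx))).
    by rewrite -scalerDr; apply: sp.2 => //; exact/DD/CD.
  move: a0; rewrite le_eqVlt => /orP[/eqP a0|a0].
    by rewrite -a0 mul0r; have := mt _ C0; rewrite -a0 mul0r.
  by rewrite -ler_pdivrMl//; apply: lem => g Cg; rewrite ler_pdivrMl//; exact: mt.
have [L [LD LZ Lm]] := linear_minorant sm.
exists L; split=> // [x Dx|g Cg].
  by apply: (le_trans (Lm _ Dx)); have := mle 0 x C0 Dx; rewrite addr0.
have := Lm _ (DN _ (CD _ Cg)); have := mle g (- g) Cg (DN _ (CD _ Cg)).
by rewrite addNr sublinear0// -scaleN1r LZ ?mulN1r; [lra|exact: CD].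
Qed.

End sublinear.

(** * The upper integral of a supremum over the latent variable *)

Section bounded.
Context (R : realType).

Definition bfun (T : Type) (f : T -> R) := exists M, forall x, `|f x| <= M.

Lemma bfunE (T : Type) (f : T -> R) : bfun f -> exists2 M, 0 < M & forall x, `|f x| <= M.
Proof.
move=> [M fM]; exists (Num.max M 1); first by rewrite lt_max ltr01 orbT.
by move=> x; rewrite le_max fM.
Qed.

Lemma bfun0 (T : Type) : bfun (0 : T -> R).
Proof. by exists 0 => x; rewrite normr0. Qed.

Lemma bfunD (T : Type) (f g : T -> R) : bfun f -> bfun g -> bfun (f + g).
Proof.
move=> [M fM] [N gN]; exists (M + N) => x.
exact: le_trans (ler_normD _ _) (lerD (fM x) (gN x)).
Qed.

Lemma bfunZ (T : Type) (a : R) (f : T -> R) : bfun f -> bfun (a *: f).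
Proof. by move=> [M fM]; exists (`|a| * M) => x; rewrite normrM ler_wpM2l. Qed.

Lemma bfunM (T : Type) (f g : T -> R) : bfun f -> bfun g -> bfun (f \* g).
Proof.
move=> [M fM] [N gN]; exists (M * N) => x /=.
by rewrite normrM ler_pM.
Qed.

Lemma bfun_comp (T U : Type) (f : T -> R) (g : U -> T) : bfun f -> bfun (f \o g).
Proof. by move=> [M fM]; exists M => x /=. Qed.

Lemma bfun_cst (T : Type) (c : R) : bfun (fun _ : T => c).
Proof. by exists `|c| => x. Qed.

Lemma bfun_bool (T : Type) (b : T -> bool) : bfun (fun x => (b x)%:R).
Proof. by exists 1 => x; case: (b x); rewrite ?normr1 ?normr0. Qed.

Lemma bfun_integrable d (T : measurableType d) (mu : {finite_measure set T -> \bar R})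
    (D : set T) (f : T -> R) : measurable D -> measurable_fun D f -> bfun f ->
  mu.-integrable D (EFin \o f).
Proof.
move=> mD mf /bfunE[M M0 fM]; apply: measurable_bounded_integrable => //.
  by rewrite ltey_eq fin_num_measure.
exists M; split; first exact: num_real.
by move=> N MN x _; exact: le_trans (fM x) (ltW MN).
Qed.

End bounded.
#[global] Hint Resolve bfun0 bfun_cst bfun_bool : core.

Section upper_integral.
Context (R : realType) d (T : measurableType d) (A : Type) (P : probability T R).
Variables (W : set T) (K : set A).
Hypotheses (mW : measurable W) (PW : P W = 1%E) (K0 : K !=set0).

(** Bounding f (w, a) for all a in [K] by one measurable u w expresses the upper integral of the
    supremum over a without integrating that supremum, which may fail to be measurable for an
    arbitrary bounded f. *)
Definition upint (f : T * A -> R) : R :=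
  inf [set \int[P]_(w in W) u w | u in
    [set u | [/\ measurable_fun W u, bfun u &
                 forall w a, W w -> K a -> f (w, a) <= u w]]].

Let PW_int (u v : T -> R) : measurable_fun W u -> bfun u ->
  measurable_fun W v -> bfun v -> (forall w, W w -> u w <= v w) ->
  \int[P]_(w in W) u w <= \int[P]_(w in W) v w.
Proof. by move=> *; apply: le_Rintegral => //; exact: bfun_integrable. Qed.

Let PW_cst c : \int[P]_(w in W) c = c.
Proof.
transitivity (c * fine (P W)); first exact: Rintegral_cst.
by rewrite PW mulr1.
Qed.

Lemma upint_le f u : bfun f -> measurable_fun W u -> bfun u ->
  (forall w a, W w -> K a -> f (w, a) <= u w) ->
  upint f <= \int[P]_(w in W) u w.
Proof.
move=> [M fM] mu bu fu; apply: ge_inf; last by exists u.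
exists (- M) => _ [v [mv bv fv] <-]; rewrite -(PW_cst (- M)).
apply: PW_int => // w Ww; have [a Ka] := K0.
by apply: le_trans (fv _ _ Ww Ka); have := fM (w, a); rewrite ler_norml => /andP[].
Qed.

Lemma upint_ge f c : bfun f ->
  (forall u, measurable_fun W u -> bfun u ->
    (forall w a, W w -> K a -> f (w, a) <= u w) -> c <= \int[P]_(w in W) u w) ->
  c <= upint f.
Proof.
move=> [M fM] h; apply: lb_le_inf.
  exists (\int[P]_(w in W) M), (fun=> M) => //; split=> // w a _ _.
  by have := fM (w, a); rewrite ler_norml => /andP[].
by move=> _ [u [mu bu fu] <-]; exact: h.
Qed.

Lemma upint_sublinear : sublinear_on (@bfun R (T * A)) upint.
Proof.
split=> [f g bf bg|a f a0 bf].
  rewrite -lerBlDr; apply: upint_ge => // u mu bu fu.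
  rewrite lerBlDr [_ + upint g]addrC -lerBlDr; apply: upint_ge => // v mv bv gv.
  rewrite lerBlDr [_ + \int[P]_(w in W) u w]addrC -RintegralD//; [|exact: bfun_integrable..].
  apply: upint_le; [exact: bfunD|exact: measurable_funD|exact: bfunD|].
  by move=> w b Ww Kb; exact: lerD (fu _ _ Ww Kb) (gv _ _ Ww Kb).
have ua u : measurable_fun W u -> bfun u ->
    (forall w a, W w -> K a -> f (w, a) <= u w) ->
    upint (a *: f) <= a * \int[P]_(w in W) u w.
  move=> mu bu fu; rewrite -RintegralZl//; last exact: bfun_integrable.
  apply: upint_le; [exact: bfunZ|exact: measurable_funM|exact: bfunZ|].
  by move=> w b Ww Kb; apply: ler_wpM2l => //; exact: fu.
move: a0; rewrite le_eqVlt => /orP[/eqP a0|a0].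
  have [M fM] := bf; have := ua (fun=> M) (measurable_cst _) (bfun_cst _ _).
  rewrite -a0 !mul0r; apply => w b _ _.
  by have := fM (w, b); rewrite ler_norml => /andP[].
rewrite -ler_pdivrMl//; apply: upint_ge => // u mu bu fu.
by rewrite ler_pdivrMl//; exact: ua.
Qed.

(* The functional plays the role of the law of [(w, a)]; it is only finitely
   additive. *)
Theorem upint_minorant_cone (C : set (T * A -> R)) :
  C `<=` @bfun R (T * A) -> C 0 -> (forall g h, C g -> C h -> C (g + h)) ->
  (forall a g, 0 <= a -> C g -> C (a *: g)) -> (forall g, C g -> 0 <= upint g) ->
  exists L : (T * A -> R) -> R,
    [/\ forall f g, bfun f -> bfun g -> L (f + g) = L f + L g,
        forall a f, bfun f -> L (a *: f) = a * L f,
        forall f g, bfun f -> bfun g ->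
          (forall w a, W w -> K a -> f (w, a) <= g (w, a)) -> L f <= L g,
        forall u, measurable_fun W u -> bfun u ->
          L (u \o fst) = \int[P]_(w in W) u w
      & forall g, C g -> 0 <= L g].
Proof.
move=> Cb C0 CD CZ Cp.
have [L [LD LZ Lp LC]] := linear_minorant_cone (@bfun0 R (T * A)) (@bfunD R _)
  (@bfunZ R _) upint_sublinear Cb C0 CD CZ Cp.
have LN f : bfun f -> L (- f) = - L f by move=> bf; rewrite -scaleN1r LZ// mulN1r.
have bN (U : Type) (f : U -> R) : bfun f -> bfun (- f).
  by rewrite -scaleN1r; exact: bfunZ.
exists L; split=> // [f g bf bg fg|u mu bu].
  rewrite -subr_ge0 -oppr_le0 opprB -LN// -LD//; last exact: bN.
  apply: (le_trans (Lp _ (bfunD bf (bN _ _ bg)))).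
  rewrite -[leRHS](PW_cst 0); apply: upint_le => //; first exact/bfunD/bN.
  by move=> w a Ww Ka /=; rewrite subr_le0; exact: fg.
have bu1 : bfun (u \o @fst T A) by exact: bfun_comp.
(* A function of w is its own best majorant, so [upint] is at most the integral at [u \o fst] and at
   its negative; the two bounds pin [L] down. *)
apply/eqP; rewrite eq_le; apply/andP; split.
  by apply: (le_trans (Lp _ bu1)); exact: upint_le.
rewrite -lerN2 -LN// -[leRHS]mulN1r -RintegralZl//; last exact: bfun_integrable.
apply: (le_trans (Lp _ (bN _ _ bu1))); apply: upint_le.
- exact: bN.
- exact: measurable_funM.
- by apply: bfunM => //; exact: bfun_cst.
- by move=> w a _ _ /=; rewrite mulN1r.
Qed.

End upper_integral.

(** * Densities of dominated contents *)

(** On the set where g < f the difference f - g is positive, yet its integral there is at most 0, so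
    the set is null. This turns inequalities between integrals over all events into almost sure
    inequalities between densities. *)
Lemma lt_set_null (R : realType) d (T : measurableType d)
    (mu : {finite_measure set T -> \bar R}) (f g : T -> R) :
  mu.-integrable setT (EFin \o f) -> mu.-integrable setT (EFin \o g) ->
  (forall E, measurable E ->
    (\int[mu]_(x in E) (f x)%:E <= \int[mu]_(x in E) (g x)%:E)%E) ->
  mu [set x | g x < f x] = 0%E.
Proof.
move=> intf intg fg.
have mf : measurable_fun setT f by apply/measurable_EFinP; exact: measurable_int intf.
have mg : measurable_fun setT g by apply/measurable_EFinP; exact: measurable_int intg.
set E := [set x | g x < f x].
have mE : measurable E.
  rewrite [E](_ : _ = setT `&` [set x | (g \_ setT) x < f x]); last first.
    by rewrite patch_setT setTI.
  by rewrite patch_setT; apply: measurable_fun_ltr.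
have intEf : mu.-integrable E (EFin \o f) by exact: integrableS intf.
have intEg : mu.-integrable E (EFin \o g) by exact: integrableS intg.
have int0 : (\int[mu]_(x in E) `|(f x - g x)%:E| = 0)%E.
  apply/eqP; rewrite eq_le integral_ge0// andbT.
  rewrite (eq_integral (fun x => (f x)%:E - (g x)%:E)%E); last first.
    move=> x; rewrite inE /E /= => gf.
    by rewrite -EFinB ger0_norm// subr_ge0 ltW.
  rewrite integralB_EFin// sube_le0 ?fg//.
have mfg : measurable_fun E (EFin \o (f \- g)).
  by apply/measurable_EFinP; apply: measurable_funTS; exact: measurable_funB.
have [aeE _] := ae_eq_integral_abs mu mE mfg; have [N [mN N0 subN]] := aeE int0.
apply: (subset_measure0 mE mN) => // x Ex; apply: subN => /= /(_ Ex) /= [].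
by apply/eqP; rewrite gt_eqF// subr_gt0.
Qed.

Section dominated_content.
Context (R : realType) d (T : measurableType d) (P : probability T R).
Variable m : set T -> R.
Hypotheses (m_ge0 : forall A, 0 <= m A)
  (mU : forall A B, measurable A -> measurable B -> [disjoint A & B] ->
    m (A `|` B) = m A + m B)
  (mP : forall A, measurable A -> m A <= fine (P A)).

Definition dominated_content (A : set T) : \bar R := (m A)%:E.
Local Notation mu := dominated_content.

Let m0 : mu set0 = 0%E.
Proof.
have := mP measurable0; rewrite measure0/= => h.
by congr EFin; apply/eqP; rewrite eq_le h m_ge0.
Qed.

Let mu_ge0 A : (0 <= mu A)%E. Proof. by rewrite lee_fin. Qed.

(** The tails [U n] of a disjoint sequence decrease to the empty set, so m (U n) <= P (U n) tends to
    0; finite additivity then gives convergence of the partial sums. *)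
Let mu_sigma : semi_sigma_additive mu.
Proof.
move=> F mF tF mUF.
pose U n := \bigcup_(i in [set i | (n <= i)%N]) F i.
have mUn n : measurable (U n) by exact: bigcup_measurable.
have US n : U n = F n `|` U n.+1.
  apply/seteqP; split=> [x [i /= ni Fx]|x [Fx|[i /= ni Fx]]].
  - move: ni; rewrite leq_eqVlt => /orP[/eqP nE|ni]; first by left; rewrite nE.
    by right; exists i.
  - by exists n => /=.
  - by exists i => //=; exact: ltnW.
have dU n : [disjoint F n & U n.+1].
  apply/disj_set2P; apply/seteqP; split=> // x [Fn [i /= ni Fi]].
  have /trivIsetP/(_ n i I I) := tF; rewrite ltn_eqF// => /(_ isT) FF.
  by have : (F n `&` F i) x by []; rewrite FF.
have E n : m (\bigcup_k F k) = (\sum_(0 <= i < n) m (F i)) + m (U n).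
  elim: n => [|n ih].
    by rewrite big_geq// add0r; congr m; apply: eq_bigcupl; split.
  by rewrite ih big_nat_recr//= -addrA; congr (_ + _); rewrite -mU// US.
have PU0 : P (U n) @[n --> \oo] --> 0%E.
  have cap0 : \bigcap_n U n = set0.
    apply/seteqP; split=> // x Ux; have [i _ Fi] := Ux 0%N I.
    have [j /= ij Fj] := Ux i.+1 I.
    have /trivIsetP/(_ i j I I) := tF; rewrite ltn_eqF// => /(_ isT) FF.
    by have : (F i `&` F j) x by []; rewrite FF.
  rewrite -(measure0 P) -cap0; apply: nonincreasing_cvg_mu => //.
  - by rewrite ltey_eq fin_num_measure.
  - by rewrite cap0.
  - move=> i j ij; apply/subsetPset => x [k /= jk Fk]; exists k => //=.
    exact: leq_trans jk.
have mU0 : m (U n) @[n --> \oo] --> 0.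
  apply: (@squeeze_cvgr _ _ _ _ (fun=> 0) (fun n => fine (P (U n)))).
  - by near=> n; rewrite m_ge0 mP.
  - exact: cvg_cst.
  - exact: fine_cvg.
rewrite (_ : (fun n => _) = EFin \o (fun n => m (\bigcup_k F k) - m (U n))); last first.
  by apply/funext => n /=; rewrite (E n) addrK sumEFin.
apply: cvg_EFin; first by near=> n.
rewrite -[X in _ --> X]subr0.
by apply: cvgB => //; exact: cvg_cst.
Unshelve. all: by end_near. Qed.

HB.instance Definition _ := isMeasure.Build _ _ _ mu m0 mu_ge0 mu_sigma.

Let mu_fin : fin_num_fun mu. Proof. by []. Qed.

HB.instance Definition _ := Measure_isFinite.Build _ _ _ mu mu_fin.

(** The Radon-Nikodym density is at most 1 almost everywhere; truncation at 1 makes the bound hold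
    at every point, so that each value can serve as a probability for the uniform variable. *)
Lemma dominated_content_density : exists G : T -> R,
  [/\ measurable_fun setT G, forall x, 0 <= G x <= 1
    & forall A, measurable A -> m A = \int[P]_(x in A) G x].
Proof.
have dom : mu `<< P.
  apply/null_content_dominatesP => A mA PA.
  congr EFin; apply/eqP; rewrite eq_le m_ge0 andbT.
  by apply: (le_trans (mP mA)); rewrite PA.
have [f [f0 ffin intf fE]] := radon_nikodym_sigma_finite dom.
pose g := fine \o f.
have gE : EFin \o g = f by apply/funext => x /=; rewrite fineK.
have intg : P.-integrable setT (EFin \o g) by rewrite gE.
have int1 : P.-integrable setT (EFin \o (fun=> 1 : R)) by exact: bfun_integrable.
have mg : measurable_fun setT g by apply/measurable_EFinP; exact: measurable_int intg.
have null : P [set x | 1 < g x] = 0%E.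
  apply: lt_set_null => // A mA.
  rewrite integral_cst// mul1e (eq_integral f); last by move=> x _; rewrite -gE.
  by rewrite -fE// -[leRHS]fineK ?fin_num_measure// lee_fin mP.
exists (fun x => Num.min 1 (g x)); split.
- exact: measurable_minr.
- by move=> x; rewrite le_min ler01 ge_min lexx fine_ge0//= f0.
move=> A mA; rewrite /Rintegral (_ : (\int[P]_(x in A) _)%E = mu A)//.
rewrite fE//; apply: ae_eq_integral => //.
- by apply/measurable_EFinP/measurable_funTS; exact: measurable_minr.
- by apply: measurable_funTS; exact: measurable_int intf.
exists [set x | 1 < g x]; split => //.
  rewrite -[X in measurable X]setTI; exact: measurable_fun_ltr.
move=> x /= /not_implyP[_]; rewrite -gE /= => h; rewrite ltNge; apply/negP => g1.
by apply: h; rewrite min_r.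
Qed.

End dominated_content.

(** * Comparison of positive functionals through indicators *)

Section functional_comparison.
Context (R : realType) d (T : measurableType d).

Definition bmeas (g : T -> R) := measurable_fun setT g /\ bfun g.

Let Sn (g : T -> R) (delta : R) n x : R :=
  \sum_(i < n) delta * \1_[set x | delta *+ i.+1 <= g x] x.

(** [Sn] is the lower staircase of g: delta times the number of levels delta, 2 delta, ..., n delta
    that g reaches. It falls short of g by at most delta as long as g does not exceed the top
    level. *)
Lemma layer_cake (g : T -> R) delta n x : 0 <= delta -> 0 <= g x ->
  Sn g delta n x <= g x /\ (g x <= delta *+ n -> g x <= Sn g delta n x + delta).
Proof.
move=> d0 g0.
have Sle k j : (k <= j)%N -> delta *+ j <= g x -> Sn g delta k x = delta *+ k.
  move=> kj gx; rewrite /Sn (eq_bigr (fun=> delta)).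
    by rewrite sumr_const card_ord.
  move=> i _; rewrite indicE mem_set ?mulr1//=; apply: le_trans gx.
  by rewrite -[leLHS]mulr_natr -[leRHS]mulr_natr ler_wpM2l// ler_nat (leq_trans (ltn_ord i)).
elim: n => [|n [ih1 ih2]].
  by rewrite /Sn big_ord0 mulr0n add0r; split => // g0'; exact: le_trans g0' d0.
have -> : Sn g delta n.+1 x = Sn g delta n x + delta * \1_[set x | delta *+ n.+1 <= g x] x.
  by rewrite /Sn big_ord_recr.
have [gn|gn] := leP (delta *+ n.+1) (g x).
  rewrite indicE mem_set//= mulr1 (Sle n n.+1)// -mulrSr; split => // gn'.
  by rewrite (le_trans gn')// lerDl.
rewrite indicE memNset/= ?mulr0 ?addr0; last by apply/negP; rewrite -ltNge.
split=> // _; have [/ih2//|/ltW gn'] := leP (g x) (delta *+ n).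
by rewrite (Sle n n)// -mulrSr ltW.
Qed.

Definition pos_linear (I : (T -> R) -> R) :=
  [/\ forall f g, bmeas f -> bmeas g -> I (f \+ g) = I f + I g,
      forall a f, bmeas f -> I (fun x => a * f x) = a * I f
    & forall f g, bmeas f -> bmeas g -> (forall x, f x <= g x) -> I f <= I g].

(** A nonnegative bounded g is uniformly close to a positive combination of indicators of its level
    sets. Uniform closeness matters: a positive functional need not be continuous along monotone
    limits, but it controls an error delta by delta times its value at 1. *)
Lemma pos_linear_le (I J : (T -> R) -> R) : pos_linear I -> pos_linear J ->
  (forall A, measurable A -> I \1_A <= J \1_A) ->
  forall g, bmeas g -> (forall x, 0 <= g x) -> I g <= J g.
Proof.
move=> [ID IZ Im] [JD JZ Jm] IJ g [mg bg] g0.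
have [M M0 gM] := bfunE bg.
have bmS delta n : bmeas (Sn g delta n) /\ (0 <= delta -> I (Sn g delta n) <= J (Sn g delta n)).
  have bm1 i : bmeas (\1_[set x | delta *+ i <= g x] : T -> R).
    split; last by apply: bfun_bool.
    apply: measurable_indic; rewrite -[X in measurable X]setTI.
    exact: measurable_fun_ler.
  have bmc (c : R) : bmeas (fun _ : T => c) by split => //; exact: measurable_cst.
  have bmz i : bmeas (fun x => delta * \1_[set x | delta *+ i <= g x] x).
    by have [b1 b2] := bm1 i; split; [exact: measurable_funM|apply: bfunM].
  elim: n => [|n [[ih1 ih1'] ih2]].
    have -> : Sn g delta 0 = (fun x => 0 * (fun=> 0) x).
      by apply/funext => x; rewrite /Sn big_ord0 mul0r.
    split; first by split; [exact: measurable_funM|exact: bfunM].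
    by move=> _; rewrite IZ// JZ// !mul0r.
  have -> : Sn g delta n.+1 = Sn g delta n \+
      (fun x => delta * \1_[set x | delta *+ n.+1 <= g x] x).
    by apply/funext => x; rewrite /Sn big_ord_recr.
  have [b1 b2] := bmz n.+1.
  split; first by split; [exact: measurable_funD|exact: bfunD].
  move=> d0; rewrite ID// JD//; apply: lerD; first exact: ih2.
  rewrite IZ// JZ//; apply: ler_wpM2l => //; apply: IJ.
  rewrite -[X in measurable X]setTI; exact: measurable_fun_ler.
have bmc (c : R) : bmeas (fun _ : T => c) by split => //; exact: measurable_cst.
have I1 : 0 <= I (fun=> 1).
  have := Im (fun=> 0) (fun=> 1) (bmc _) (bmc _) (fun _ => ler01).
  by rewrite (_ : (fun=> 0) = (fun x => 0 * (fun=> 0) x)) ?IZ ?mul0r//; apply/funext => x; rewrite mul0r.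
apply/ler_addgt0Pr => e e0.
(* The staircase with n steps of height M / n reaches the bound M of g and costs M / n times I(1),
   which this n makes smaller than e. *)
pose n := (Num.truncn (M * I (fun=> 1) / e)).+1.
pose delta := M / n%:R.
have d0 : 0 <= delta by rewrite divr_ge0// ltW.
have [bS IJS] := bmS delta n.
have dn : delta *+ n = M by rewrite -mulr_natr mulfVK// pnatr_eq0.
have lc x := layer_cake n d0 (g0 x).
apply: (@le_trans _ _ (I (Sn g delta n) + delta * I (fun=> 1))).
  have bT : bmeas (Sn g delta n \+ (fun=> delta * 1)).
    by have [b1 b2] := bS; split; [exact: measurable_funD|exact: bfunD].
  rewrite -IZ; last exact: bmc.
  rewrite -ID; [|exact: bS|exact: (bmc (delta * 1))].
  apply: (Im g _ (conj mg bg) bT).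
  move=> x /=; rewrite mulr1; apply: (lc x).2.
  by rewrite dn; have := gM x; rewrite ger0_norm.
apply: lerD.
  by apply: (le_trans (IJS d0)); apply: Jm => // x; exact: (lc x).1.
rewrite /delta mulrAC ler_pdivrMr ?ltr0n// -ler_pdivrMl//.
by rewrite [leLHS]mulrC ltW// truncnS_gt.
Qed.

End functional_comparison.

(** * Sampling from a kernel *)

Lemma uniform_prob_lt (R : realType) (g : R) : 0 <= g <= 1 ->
  uniform_prob (@ltr01 R) [set u | u < g] = g%:E.
Proof.
move=> /andP[g0 g1]; rewrite /uniform_prob integral_uniform_pdf.
rewrite [X in integral _ X _](_ : _ = `[0, g[%classic); last first.
  apply/seteqP; split=> x /=; rewrite !in_itv/=; first by case=> -> /andP[-> _].
  by move=> /andP[-> xg]; rewrite xg (ltW (lt_le_trans xg g1)).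
rewrite (eq_integral (fun=> 1%E)).
  rewrite integral_cst//= mul1e lebesgue_measure_itv/= lte_fin.
  case: ltP => [|]; first by rewrite oppr0 addr0.
  by move=> g0'; congr EFin; apply/eqP; rewrite eq_le g0 g0'.
move=> x; rewrite inE/= in_itv/= /uniform_pdf => /andP[x0 xg].
by rewrite x0 (ltW (lt_le_trans xg g1)) subr0 invr1.
Qed.

(* [P \x U] carries an auxiliary uniform variable [V], used to sample from
   conditional laws by the quantile transform. *)
Section randomize.
Context (R : realType) d (T : measurableType d) d' (T' : measurableType d').
Context (P : probability T R) (U : probability T' R) (V : T' -> R).
Hypothesis mV : measurable_fun setT V.
Hypothesis V_unif : forall g, 0 <= g <= 1 -> U [set u | V u < g] = g%:E.

Definition randomize : set (T * T') -> \bar R := (P \x U)%E.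

HB.instance Definition _ := Measure.on randomize.

Let randomize_setT : randomize setT = 1%E.
Proof.
by rewrite /randomize -setXTT product_measure1E//= !probability_setT mule1.
Qed.

HB.instance Definition _ :=
  Measure_isProbability.Build _ _ _ randomize randomize_setT.

Lemma randomize_fst (B : set T) : measurable B -> randomize (B `*` setT) = P B.
Proof.
by move=> mB; rewrite /randomize product_measure1E//= probability_setT mule1.
Qed.

Lemma measurable_under_graph (B : set T) (G : T -> R) :
  measurable B -> measurable_fun setT G ->
  measurable [set x : T * T' | B x.1 /\ V x.2 < G x.1].
Proof.
move=> mB mG.
have -> : [set x : T * T' | B x.1 /\ V x.2 < G x.1] =
    (fst @^-1` B) `&` [set x | (V \o snd) x < (G \o fst) x] by [].
apply: measurableI; first by rewrite -[X in measurable X]setTI; exact: measurable_fst.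
rewrite -[X in measurable X]setTI.
by apply: measurable_fun_ltr => //; exact: measurableT_comp.
Qed.

Lemma randomize_under_graph (B : set T) (G : T -> R) :
  measurable B -> measurable_fun setT G -> (forall w, 0 <= G w <= 1) ->
  randomize [set x | B x.1 /\ V x.2 < G x.1] = (\int[P]_(w in B) G w)%:E.
Proof.
move=> mB mG G01.
have mE := measurable_under_graph mB mG.
rewrite /randomize /product_measure1 /=.
rewrite (eq_integral ((EFin \o G) \_ B)); last first.
  move=> w _; rewrite /= patchE; case: ifPn => [|/negP]; rewrite inE => Bw.
    transitivity (U [set u | V u < G w]); last exact: V_unif.
    congr (U _).
    by apply/seteqP; split=> u; rewrite /xsection/= inE//= => -[].
  rewrite (_ : xsection _ w = set0) ?measure0//.
  by apply/seteqP; split=> // u; rewrite /xsection/= inE//= => -[].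
rewrite -integral_mkcond fineK//; apply: integrable_fin_num => //.
apply: bfun_integrable => //; first exact: measurable_funTS.
exists 1 => w; have /andP[G0 G1] := G01 w; by rewrite ger0_norm.
Qed.

End randomize.

Section rational_sequence.
Context (R : realType).

Definition ratn (n : nat) : R := ratr (odflt 0 (unpickle n)).

Lemma ratn_dense (a b : R) : a < b -> exists n, a < ratn n < b.
Proof.
move=> /rat_in_itvoo[q]; rewrite in_itv/= => aqb.
by exists (pickle q); rewrite /ratn pickleK.
Qed.

End rational_sequence.

(** If a lies in the half-open cell from c_m to c_(m+1), right end included, exactly the jumps at
    c_0, ..., c_m are active and the sum telescopes to h (c_(m+1)), a value at distance at most eta
    in the argument. At a = lo no jump is active. *)
Lemma step_approx (R : realType) (h : R -> R) (C eta lo : R) : 0 <= eta ->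
  (forall a b, `|h a - h b| <= C * `|a - b|) ->
  let c (j : nat) := lo + j%:R * eta in
  forall n a, lo <= a <= c n ->
  `|h a - (h lo + \sum_(j < n) (h (c j.+1) - h (c j)) * (c j < a)%R%:R)| <= C * eta.
Proof.
move=> eta0 hC c n a /andP[loa an].
have C0 : 0 <= C by have := hC 1 0; rewrite subr0 normr1 mulr1; exact: le_trans.
have cS j : c j.+1 = c j + eta by rewrite /c -natr1 mulrDl mul1r addrA.
pose S m := h lo + \sum_(j < m) (h (c j.+1) - h (c j)) * (c j < a)%R%:R.
rewrite -/(S n).
have SS m : S m.+1 = S m + (h (c m.+1) - h (c m)) * (c m < a)%R%:R.
  by rewrite /S big_ord_recr addrA.
have Sa m : (m = 0%N \/ c m.-1 < a) -> S m = h (c m).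
  elim: m => [_|m ih [//|/= ma]].
    by rewrite /S big_ord0 addr0 /c mul0r addr0.
  rewrite SS ma mulr1 ih; first by rewrite addrC subrK.
  case: m ma {ih} => [|m] ma; [by left|right => /=].
  by apply: le_lt_trans ma; rewrite cS lerDl.
elim: n an => [|n ih] an.
  have -> : a = lo by apply/eqP; rewrite eq_le loa andbT; move: an; rewrite /c mul0r addr0.
  by rewrite Sa; [rewrite /c mul0r addr0 subrr normr0 mulr_ge0|left].
have [cna|acn] := ltP (c n) a.
  rewrite Sa; last by right.
  apply: (le_trans (hC _ _)); rewrite ler_wpM2l// ler_norml; move: an; rewrite cS; lra.
by rewrite SS ltNge acn/= mulr0 addr0 ih.
Qed.

(** * From a finitely additive law to a law *)

Lemma indic_bool (R : realType) (T : Type) (b : T -> bool) (x : T) :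
  \1_[set x | b x] x = (b x)%:R :> R.
Proof.
rewrite indicE; congr (nat_of_bool _)%:R.
by apply/idP/idP; rewrite inE.
Qed.

Section riesz.
Context (R : realType) d (T : measurableType d) d' (T' : measurableType d').
Context (P : probability T R) (U : probability T' R) (V : T' -> R).
Hypothesis mV : measurable_fun setT V.
Hypothesis V_unif : forall g, 0 <= g <= 1 -> U [set u | V u < g] = g%:E.
Variables (lo hi : R) (L : (T * R -> R) -> R).
Hypothesis lohi : lo < hi.
Hypothesis LD : forall f g, bfun f -> bfun g -> L (f + g) = L f + L g.
Hypothesis LZ : forall (a : R) f, bfun f -> L (a *: f) = a * L f.
Hypothesis L_le : forall f g, bfun f -> bfun g ->
  (forall w a, lo <= a <= hi -> f (w, a) <= g (w, a)) -> L f <= L g.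
Hypothesis L_fst : forall u, bmeas u -> L (u \o fst) = \int[P]_w u w.

Definition cut (g : T -> R) (c : R) : T * R -> R := fun x => g x.1 * (c < x.2)%R%:R.

Lemma bfun_cut g c : bfun g -> bfun (cut g c).
Proof. by move=> bg; apply: bfunM => //; apply: (bfun_comp fst bg). Qed.

Lemma measurable_cut g c : measurable_fun setT g -> measurable_fun setT (cut g c).
Proof.
move=> mg; apply: measurable_funM; first exact: measurableT_comp.
have -> : (fun x : T * R => (c < x.2)%R%:R) = \1_[set x | c < x.2] :> (T * R -> R).
  by apply/funext => x; rewrite indic_bool.
apply: measurable_indic; rewrite -[X in measurable X]setTI.
by apply: measurable_fun_ltr => //; exact: measurable_snd.
Qed.

Lemma bmeas_indic (A : set T) : measurable A -> bmeas (\1_A : T -> R).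
Proof. by move=> mA; split; [exact: measurable_indic|exact: bfun_bool]. Qed.

Lemma bmeas_integrable (Q : probability T R) (D : set T) g :
  measurable D -> bmeas g -> Q.-integrable D (EFin \o g).
Proof.
by move=> mD [mg bg]; apply: bfun_integrable => //; exact: measurable_funTS.
Qed.

Lemma pos_linear_cutL c : pos_linear (fun g => L (cut g c)).
Proof.
split=> [f g [mf bf] [mg bg]|a f [mf bf]|f g [mf bf] [mg bg] fg].
- rewrite -LD; [|exact: bfun_cut..]; congr L; apply/funext => x.
  by rewrite /cut /= mulrDl.
- by rewrite -LZ; [|exact: bfun_cut]; congr L; apply/funext => x; rewrite /cut /= -mulrA.
- apply: L_le; [exact: bfun_cut..|] => w a _.
  by rewrite /cut /= ler_wpM2r.
Qed.

Let nu c (A : set T) := L (cut \1_A c).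

Let nu_ge0 c A : 0 <= nu c A.
Proof.
have <- : L (0 *: (0 : T * R -> R)) = 0 by rewrite LZ// mul0r.
apply: L_le; [exact: bfunZ|exact/bfun_cut/bfun_bool|] => w a _.
by rewrite /cut/= [leLHS]mul0r mulr_ge0.
Qed.

Let nuU c A B : measurable A -> measurable B -> [disjoint A & B] ->
  nu c (A `|` B) = nu c A + nu c B.
Proof.
move=> mA mB /disj_set2P AB; rewrite /nu -LD; [|exact/bfun_cut/bfun_bool..].
congr L; apply/funext => x; rewrite /cut /= -[RHS]mulrDl; congr (_ * _).
rewrite !indicE in_setU -natrD; congr (_%:R).
have : ~ (A `&` B) x.1 by rewrite AB.
by case: (boolP (x.1 \in A)); case: (boolP (x.1 \in B)) => //; rewrite !inE => ? ?; case.
Qed.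

Let Rint_indic (Q : probability T R) A : measurable A ->
  \int[Q]_w \1_A w = fine (Q A).
Proof. by move=> mA; rewrite /Rintegral integral_indic// setIT. Qed.

Let nuP c A : measurable A -> nu c A <= fine (P A).
Proof.
move=> mA; rewrite -Rint_indic// -L_fst; last exact: bmeas_indic.
apply: L_le; [exact/bfun_cut/bfun_bool|exact/bfun_comp/bfun_bool|] => w a _.
by rewrite /cut /= ler_piMr// lern1 leq_b1.
Qed.

Let nu_le c c' A : c <= c' -> nu c' A <= nu c A.
Proof.
move=> cc'; apply: L_le; [exact/bfun_cut/bfun_bool..|] => w a _.
rewrite /cut /= ler_wpM2l// ler_nat; have [ca|//] := ltP c' a.
by rewrite (le_lt_trans cc' ca).
Qed.

Lemma cut_density c : exists G : T -> R,
  [/\ measurable_fun setT G, forall w, 0 <= G w <= 1 &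
      forall A, measurable A -> L (cut \1_A c) = \int[P]_(w in A) G w].
Proof.
by apply: (dominated_content_density (P := P) (m := nu c));
  [exact: nu_ge0|exact: nuU|exact: nuP].
Qed.

Variable G : R -> T -> R.
Hypothesis mG : forall c, measurable_fun setT (G c).
Hypothesis G01 : forall c w, 0 <= G c w <= 1.
Hypothesis GE : forall c A, measurable A -> L (cut \1_A c) = \int[P]_(w in A) G c w.

Let bG c : bmeas (G c).
Proof.
split=> //; exists 1 => w; have /andP[G0 G1] := G01 c w; by rewrite ger0_norm.
Qed.

(** The densities decrease in c only almost surely, with an exceptional set depending on the two
    levels. *)
Let G_null c c' : c <= c' -> P [set w | G c w < G c' w] = 0%E.
Proof.
move=> cc'; apply: lt_set_null; [exact: bmeas_integrable..|] => A mA.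
rewrite -[leLHS]fineK ?integrable_fin_num//; last exact: bmeas_integrable.
rewrite -[leRHS]fineK ?integrable_fin_num//; last exact: bmeas_integrable.
by rewrite lee_fin; have := nu_le A cc'; rewrite /nu !GE.
Qed.

(** The quantile transform of the survival functions c |-> G c w: the largest level still exceeding
    the uniform variable. Rational levels give measurability and keep the null sets of [G_null]
    countable in number; the point [lo] makes the set nonempty and bounds the supremum from
    below. *)
Definition quantile (x : T * T') : R :=
  sup ([set lo] `|` [set z | exists n,
    [/\ z = ratn R n, ratn R n <= hi & V x.2 < G (ratn R n) x.1]]).

Let quantile_ub x : ubound ([set lo] `|` [set z | exists n,
    [/\ z = ratn R n, ratn R n <= hi & V x.2 < G (ratn R n) x.1]]) hi.
Proof. by move=> z [->|[n [-> ? _]]] //; exact: ltW. Qed.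

Let quantile_itv x : lo <= quantile x <= hi.
Proof.
apply/andP; split.
  by apply: ub_le_sup; [exists hi; exact: quantile_ub|left].
by apply: ge_sup; [exists lo; left|exact: quantile_ub].
Qed.

Let quantile_gt c x : lo <= c -> c < quantile x <->
  exists n, [/\ c < ratn R n, ratn R n <= hi & V x.2 < G (ratn R n) x.1].
Proof.
move=> loc; split=> [|[n [cn nhi VG]]].
  move=> /sup_gt[|z [->|[n [-> nhi VG]]] cz]; first by exists lo; left.
    by move: cz; rewrite ltNge loc.
  by exists n.
apply: (lt_le_trans cn); apply: ub_le_sup; first by exists hi; exact: quantile_ub.
by right; exists n.
Qed.

Let ugraph c := [set x : T * T' | V x.2 < G c x.1].

Let m_ugraph c : measurable (ugraph c).
Proof.
have := measurable_under_graph mV measurableT (mG c).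
by congr measurable; apply/seteqP; split=> x //= [].
Qed.

Let quantile_gtE c : lo <= c -> [set x | c < quantile x] =
  \bigcup_(n in [set n | c < ratn R n <= hi]) ugraph (ratn R n).
Proof.
move=> loc; apply/seteqP; split=> x /=.
  by move=> /(quantile_gt _ loc)[n [cn nhi VG]]; exists n => //=; rewrite cn.
by move=> [n /= /andP[cn nhi] VG]; apply/(quantile_gt _ loc); exists n.
Qed.

Let m_quantile_gt c : measurable [set x | c < quantile x].
Proof.
have [loc|clo] := leP lo c.
  by rewrite quantile_gtE//; exact: bigcup_measurable.
rewrite (_ : [set x | _] = setT)//; apply/seteqP; split=> // x _ /=.
by apply: lt_le_trans clo _; have /andP[] := quantile_itv x.
Qed.

Let m_quantile : measurable_fun setT quantile.
Proof.
move=> mD; apply: (measurability _ (RGenOInfty.measurableE R)) => //.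
move=> /= _ [_ [c ->] <-]; rewrite setTI preimage_itvoy.
exact: m_quantile_gt.
Qed.

Let sample (x : T * T') : T * R := (x.1, quantile x).

Let m_sample : measurable_fun setT sample.
Proof. by apply: measurable_fun_pair => //; exact: measurable_fst. Qed.

Let RV_sample : {mfun (T * T')%type >-> (T * R)%type} := mfun_Sub (mem_set m_sample).

Definition quantile_law : probability (T * R)%type R :=
  distribution (randomize P U) RV_sample.

Let quantile_lawE A : quantile_law A = randomize P U (sample @^-1` A).
Proof. by []. Qed.

Lemma quantile_law_fst (B : set T) : measurable B ->
  quantile_law (B `*` setT) = P B.
Proof.
move=> mB; rewrite quantile_lawE -(randomize_fst P U mB); congr (randomize P U _).
Qed.

Let int_sample (f : T * R -> R) : measurable_fun setT f -> bfun f ->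
  (randomize P U).-integrable setT (EFin \o (f \o sample)).
Proof.
move=> mf bf; apply: bfun_integrable => //.
  by apply: measurableT_comp mf _; exact: m_sample.
exact: bfun_comp.
Qed.

Let quantile_law_int (f : T * R -> R) : measurable_fun setT f -> bfun f ->
  \int[quantile_law]_x f x = \int[randomize P U]_x f (sample x).
Proof.
move=> mf bf; congr fine.
have -> : (\int[randomize P U]_x (f (sample x))%:E =
  \int[randomize P U]_(x in sample @^-1` setT) ((EFin \o f) \o sample) x)%E by [].
rewrite -(integral_pushforward m_sample)//; first exact/measurable_EFinP.
exact: int_sample.
Qed.

Lemma quantile_law_le (f g : T * R -> R) : measurable_fun setT f -> bfun f ->
  measurable_fun setT g -> bfun g ->
  (forall w a, lo <= a <= hi -> f (w, a) <= g (w, a)) ->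
  \int[quantile_law]_x f x <= \int[quantile_law]_x g x.
Proof.
move=> mf bf mg bg fg; rewrite !quantile_law_int//.
apply: le_Rintegral => //; [exact: int_sample..|].
by move=> x _; apply: fg; exact: quantile_itv.
Qed.

Let above c (A : set T) := [set x : T * T' | A x.1 /\ c < quantile x].

Let m_above c A : measurable A -> measurable (above c A).
Proof.
move=> mA; rewrite [above c A](_ : _ = (fst @^-1` A) `&` [set x | c < quantile x])//.
apply: measurableI => //; first by rewrite -[X in measurable X]setTI; exact: measurable_fst.
Qed.

Let Rint_cutE c A : measurable A ->
  \int[quantile_law]_x cut \1_A c x = fine (randomize P U (above c A)).
Proof.
move=> mA; have mAc : measurable (A `*` `]c, +oo[%classic : set (T * R)).
  by apply: measurableX.
transitivity (\int[quantile_law]_x \1_(A `*` `]c, +oo[%classic) x).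
  apply: eq_Rintegral => x _; rewrite /cut !indicE in_setX -natrM mulnb.
  by congr (_%:R); congr (_ && _); rewrite mem_setE in_itv/= andbT.
rewrite /Rintegral integral_indic// setIT.
transitivity (fine (randomize P U (sample @^-1` (A `*` `]c, +oo[%classic)))) => //.
congr (fine (randomize P U _)).
by apply/seteqP; split=> x /=; rewrite in_itv/= andbT.
Qed.

(** For a rational r between c and c', the event V < G r forces the quantile above c, and its mass
    over A is nu r A >= nu c' A. The room between c and c' is what provides r. *)
Let above_lower c c' A : lo <= c -> c < c' -> c' <= hi -> measurable A ->
  nu c' A <= fine (randomize P U (above c A)).
Proof.
move=> loc cc' c'hi mA; have [n /andP[cn nc']] := ratn_dense cc'.
apply: (le_trans (nu_le A (ltW nc'))); rewrite /nu GE//.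
have rE := randomize_under_graph P mV V_unif mA (mG (ratn R n)) (G01 _).
rewrite -lee_fin -rE fineK; last exact: fin_num_measure (m_above _ mA).
apply: le_measure; rewrite ?inE//.
- exact: measurable_under_graph.
- exact: m_above.
move=> x [Ax VG]; split => //; apply/(quantile_gt _ loc); exists n; split=> //.
exact: le_trans (ltW nc') c'hi.
Qed.

(** A quantile above c means V < G r for some rational r > c. Outside the countable union [N] of
    sets where monotonicity fails, this gives V < G c, an event of mass nu c A over A. *)
Let above_upper c A : lo <= c -> measurable A ->
  fine (randomize P U (above c A)) <= nu c A.
Proof.
move=> loc mA; rewrite /nu GE//.
have rE := randomize_under_graph P mV V_unif mA (mG c) (G01 _).
have mAc := m_above c mA.
rewrite -lee_fin -rE fineK; last exact: fin_num_measure.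
pose N := \bigcup_n ([set w | c <= ratn R n /\ G c w < G (ratn R n) w] `*` [set: T']).
have nN : (randomize P U).-negligible N.
  apply: negligible_bigcup => n; have [cn|nc] := leP c (ratn R n); last first.
    apply: (@negligibleS _ _ _ _ set0); last exact: negligible_set0.
    by move=> x [[]].
  have mGG : measurable [set w | G c w < G (ratn R n) w].
    by rewrite -[X in measurable X]setTI; exact: measurable_fun_ltr.
  exists ([set w | G c w < G (ratn R n) w] `*` setT); split.
  - exact: measurableX.
  - by have := randomize_fst P U mGG; rewrite G_null.
  - by move=> x [/= []].
have [N' [mN' N'0 NN']] := nN.
apply: (@le_trans _ _ (randomize P U
    ([set x | A x.1 /\ V x.2 < G c x.1] `|` N'))).
  apply: le_measure; rewrite ?inE//.
    by apply: measurableU => //; exact: measurable_under_graph.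
  move=> x [Ax /(quantile_gt _ loc)[n [cn nhi VG]]].
  have [VGc|GcV] := ltP (V x.2) (G c x.1); [by left|right].
  apply: NN'; exists n => //=; split => //; split; first exact: ltW.
  exact: le_lt_trans VG.
apply: (le_trans (measureU2 _ _ _)) => //; first exact: measurable_under_graph.
by rewrite -[leRHS]adde0; apply: leeD => //; rewrite le_eqVlt; apply/orP; left; apply/eqP.
Qed.

Lemma bmeas_integrable2 (f : T * R -> R) : measurable_fun setT f -> bfun f ->
  quantile_law.-integrable setT (EFin \o f).
Proof. by move=> mf bf; exact: bfun_integrable. Qed.

Let pos_linear_cutM c : pos_linear (fun g => \int[quantile_law]_x cut g c x).
Proof.
have ci f : bmeas f -> quantile_law.-integrable setT (EFin \o cut f c).
  by move=> [mf bf]; apply: bmeas_integrable2; [exact: measurable_cut|exact: bfun_cut].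
split=> [f g mf mg|a f mf|f g mf mg fg].
- rewrite -RintegralD//; [|exact: ci..]; apply: eq_Rintegral => x _.
  by rewrite /cut /= mulrDl.
- rewrite -RintegralZl//; last exact: ci.
  by apply: eq_Rintegral => x _; rewrite /cut /= mulrA.
- apply: le_Rintegral => //; [exact: ci..|].
  by move=> x _; rewrite /cut /= ler_wpM2r.
Qed.

Let cut_sandwich c c' g : lo <= c -> c < c' -> c' <= hi -> bmeas g ->
  (forall w, 0 <= g w) ->
  L (cut g c') <= \int[quantile_law]_x cut g c x <= L (cut g c).
Proof.
move=> loc cc' c'hi bg g0; apply/andP; split.
  apply: (pos_linear_le (pos_linear_cutL c') (pos_linear_cutM c)) => // A mA.
  by rewrite Rint_cutE//; exact: above_lower.
apply: (pos_linear_le (pos_linear_cutM c) (pos_linear_cutL c)) => // A mA.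
by rewrite Rint_cutE//; exact: above_upper.
Qed.

Local Notation M f := (\int[quantile_law]_x f x).

Let M_add (f g : T * R -> R) : measurable_fun setT f -> bfun f ->
  measurable_fun setT g -> bfun g -> M (f \+ g) = M f + M g.
Proof. by move=> *; rewrite RintegralD//; exact: bmeas_integrable2. Qed.

Let measurable_fst_comp (u : T -> R) : measurable_fun setT u ->
  measurable_fun setT (u \o fst : T * R -> R).
Proof. by move=> mu; exact: measurableT_comp. Qed.

Let M_fst u : bmeas u -> M (u \o fst) = \int[P]_w u w.
Proof.
move=> [mu bu].
have muf := measurable_fst_comp mu.
congr fine.
have -> : (\int[quantile_law]_x ((u \o fst) x)%:E =
  \int[quantile_law]_(x in fst @^-1` setT) ((EFin \o u) \o fst) x)%E by [].
rewrite -(integral_pushforward (@measurable_fst _ _ T R))//; last 2 first.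
- exact/measurable_EFinP.
- exact: (bmeas_integrable2 muf (bfun_comp fst bu)).
apply: eq_measure_integral => A mA _.
transitivity (quantile_law (A `*` setT)); last exact: quantile_law_fst.
congr (quantile_law _).
by apply/seteqP; split=> x //= [].
Qed.

Let L_cst e : L (fun=> e) = e.
Proof.
rewrite -[LHS]/(L ((fun=> e) \o fst)) L_fst; last first.
  by split=> //; exact: measurable_cst.
transitivity (e * fine (P setT)); first exact: Rintegral_cst.
by rewrite probability_setT mulr1.
Qed.

Let M_cst e : M (fun=> e) = e.
Proof.
transitivity (e * fine (quantile_law setT)); first exact: Rintegral_cst.
by rewrite probability_setT mulr1.
Qed.

(** The sandwich needs nonnegative functions, so it is applied to g + e and to the constant e. Since
    e - g >= 0, its cut also has a smaller [L] at c' than at c, which bounds the gap of g + e by 2 e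
    times the gap of the constant 1. The difference of the two sandwiches is the claim. *)
Let cut_error c c' g e : lo <= c -> c < c' -> c' <= hi -> bmeas g ->
  (forall w, `|g w| <= e) ->
  `|L (cut g c) - M (cut g c)| <=
    2 * e * (L (cut (fun=> 1) c) - L (cut (fun=> 1) c')).
Proof.
move=> loc cc' c'hi bg ge.
have e0 : 0 <= e by have := ge point; apply: le_trans.
have bc (x : R) : bmeas (fun _ : T => x) by split=> //; exact: measurable_cst.
have bge : bmeas (g \+ fun=> e).
  by split; [apply: measurable_funD => //; exact: bg.1|exact: (bfunD bg.2 (bc e).2)].
have bge' : bmeas (fun x => -1 * (g \+ fun=> e) x).
  by split; [apply: measurable_funM => //; exact: bge.1|exact: (bfunZ (-1) bge.2)].
have bh : bmeas ((fun=> 2 * e) \+ (fun x => -1 * (g \+ fun=> e) x)).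
  split; first by apply: measurable_funD => //; exact: bge'.1.
  exact: (bfunD (bc _).2 bge'.2).
have gE w : - e <= g w <= e by rewrite -ler_norml.
have /andP[s1 s2] := cut_sandwich loc cc' c'hi bge (fun w => ltac:(
  have := gE w; rewrite /=; lra)).
have /andP[t1 t2] := cut_sandwich loc cc' c'hi (bc e) (fun _ => e0).
have [LcD LcZ _] := pos_linear_cutL c.
have [LcD' LcZ' _] := pos_linear_cutL c'.
have [McD McZ _] := pos_linear_cutM c.
have Lc x : L (cut (fun=> x) c) = x * L (cut (fun=> 1) c).
  by rewrite -LcZ//; congr L; apply/funext => y; rewrite /cut mulr1.
have Lc' x : L (cut (fun=> x) c') = x * L (cut (fun=> 1) c').
  by rewrite -LcZ'//; congr L; apply/funext => y; rewrite /cut mulr1.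
have hle : L (cut ((fun=> 2 * e) \+ (fun x => -1 * (g \+ fun=> e) x)) c') <=
           L (cut ((fun=> 2 * e) \+ (fun x => -1 * (g \+ fun=> e) x)) c).
  apply: L_le; [exact: bfun_cut bh.2..|] => w a _.
  rewrite /cut /= ler_wpM2l//; first by have := gE w; lra.
  by rewrite ler_nat; have [c'a|//] := ltP c' a; rewrite (lt_trans cc' c'a).
have Lh : L (cut ((fun=> 2 * e) \+ (fun x => -1 * (g \+ fun=> e) x)) c) =
    2 * e * L (cut (fun=> 1) c) - (L (cut g c) + e * L (cut (fun=> 1) c)).
  rewrite LcD// Lc; congr (_ + _).
  transitivity (-1 * L (cut (g \+ fun=> e) c)); first exact: LcZ.
  by rewrite LcD// (Lc e) mulN1r.
have Lh' : L (cut ((fun=> 2 * e) \+ (fun x => -1 * (g \+ fun=> e) x)) c') =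
    2 * e * L (cut (fun=> 1) c') - (L (cut g c') + e * L (cut (fun=> 1) c')).
  rewrite LcD'// Lc'; congr (_ + _).
  transitivity (-1 * L (cut (g \+ fun=> e) c')); first exact: LcZ'.
  by rewrite LcD'// (Lc' e) mulN1r.
rewrite Lh Lh' in hle; rewrite (Lc e) in t2; rewrite (Lc' e) in t1.
rewrite LcD// (Lc e) in s2; rewrite LcD'// (Lc' e) in s1; rewrite McD// in s1 s2.
rewrite ler_norml; apply/andP; split; lra.
Qed.

(** Both functionals are compared on a staircase in a with coefficients [D j], the increments of phi
    along the grid. These have size at most C eta, and the errors given by [cut_error] carry the
    factors l j - l j.+1, which telescope. *)
Lemma quantile_law_lipschitz (phi : T * R -> R) (C : R) :
  measurable_fun setT phi -> bfun phi ->
  (forall w a b, `|phi (w, a) - phi (w, b)| <= C * `|a - b|) ->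
  M phi = L phi.
Proof.
move=> mphi bphi phiC.
have C0 : 0 <= C.
  by have := phiC point 1 0; rewrite subr0 normr1 mulr1; exact: le_trans.
apply/eqP; rewrite eq_sym -subr_eq0 -normr_le0; apply/ler_addgt0Pr => e e0; rewrite add0r.
(* The 4 collects C eta for replacing phi by the staircase under each of the two functionals and 2 C
   eta for their difference on the staircase. *)
pose n := (Num.truncn (4 * C * (hi - lo) / e)).+1.
pose eta := (hi - lo) / n%:R.
have eta0 : 0 < eta by rewrite divr_gt0// ?subr_gt0// ltr0n.
pose c (j : nat) := lo + j%:R * eta.
have cn : c n = hi by rewrite /c /eta mulrC mulfVK ?pnatr_eq0// addrC subrK.
have cS j : c j.+1 = c j + eta by rewrite /c -natr1 mulrDl mul1r addrA.
have bphic a : bmeas (fun w => phi (w, a)).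
  split; last exact: (bfun_comp (fun w => (w, a)) bphi).
  by apply: measurableT_comp mphi _; exact: pair2_measurable.
pose D j w := phi (w, c j.+1) - phi (w, c j).
have bD j : bmeas (D j).
  split; first by apply: measurable_funB; [exact: (bphic _).1..].
  have := bfunD (bphic (c j.+1)).2 (bfunZ (-1) (bphic (c j)).2).
  congr bfun; apply/funext => w.
  by transitivity (phi (w, c j.+1) + -1 * phi (w, c j)); [|rewrite mulN1r].
pose SS m (x : T * R) := phi (x.1, lo) + \sum_(j < m) D j x.1 * (c j < x.2)%R%:R.
have SS0 : SS 0%N = (fun w => phi (w, lo)) \o fst.
  by apply/funext => x; rewrite /SS big_ord0 addr0.
have SSS m : SS m.+1 = SS m \+ cut (D m) (c m).
  by apply/funext => x; rewrite /SS big_ord_recr/= addrA.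
have mcut j : measurable_fun setT (cut (D j) (c j)) by have [? _] := bD j; exact: measurable_cut.
have bcut j : bfun (cut (D j) (c j)) by have [_ ?] := bD j; exact: bfun_cut.
have mSS m : measurable_fun setT (SS m).
  elim: m => [|m ih]; first by have m1 := (bphic lo).1; rewrite SS0; exact: measurable_fst_comp.
  by rewrite SSS; exact: measurable_funD.
have bSS m : bfun (SS m).
  elim: m => [|m ih]; first by rewrite SS0; exact: (bfun_comp fst (bphic lo).2).
  by rewrite SSS; exact: bfunD.
pose l j := L (cut (fun=> 1) (c j)).
pose e' := C * eta.
have e'0 : 0 <= e' by rewrite mulr_ge0// ltW.
have err m : (m <= n)%N -> `|L (SS m) - M (SS m)| <= 2 * e' * (l 0%N - l m).
  elim: m => [_|m ih mn]; first by rewrite SS0 L_fst// M_fst// !subrr normr0 mulr0.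
  rewrite SSS M_add// -[L _]/(L (SS m + cut (D m) (c m))) LD//.
  have -> : l 0%N - l m.+1 = (l 0%N - l m) + (l m - l m.+1) by lra.
  rewrite mulrDr opprD addrACA; apply: (le_trans (ler_normD _ _)).
  apply: lerD; first exact/ih/ltnW.
  apply: cut_error => //.
  - by rewrite /c lerDl mulr_ge0// ltW.
  - by rewrite cS ltrDl.
  - by rewrite -cn /c lerD2l ler_wpM2r ?ler_nat// ltW.
  - by move=> w; apply: (le_trans (phiC _ _ _)); rewrite cS addrAC subrr add0r gtr0_norm.
have approx w a : lo <= a <= hi -> `|phi (w, a) - SS n (w, a)| <= e'.
  rewrite -cn => ac.
  exact: (step_approx (h := fun a => phi (w, a)) (ltW eta0) (phiC w) ac).
(* Stated for an abstract functional so that it serves both [L] and the integral: additivity,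
   monotonicity on the strip and the value at constants suffice. *)
have close (F : (T * R -> R) -> R) :
    (forall f g : T * R -> R, measurable_fun setT f -> bfun f ->
      measurable_fun setT g -> bfun g -> F (f \+ g) = F f + F g) ->
    (forall e, F (fun=> e) = e) ->
    (forall f g : T * R -> R, measurable_fun setT f -> bfun f ->
      measurable_fun setT g -> bfun g ->
      (forall w a, lo <= a <= hi -> f (w, a) <= g (w, a)) -> F f <= F g) ->
    `|F phi - F (SS n)| <= e'.
  move=> FD Fc Fle.
  have mc : measurable_fun setT (fun _ : T * R => e') by exact: measurable_cst.
  have Fe f g : measurable_fun setT f -> bfun f -> measurable_fun setT g -> bfun g ->
      (forall w a, lo <= a <= hi -> f (w, a) <= g (w, a) + e') -> F f <= F g + e'.
    move=> mf bf mg bg fg.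
    have FE : F (g \+ (fun=> e')) = F g + e' by rewrite FD ?Fc//; exact: bfun_cst.
    rewrite -FE; apply: Fle => //; first exact: measurable_funD.
    by apply: bfunD => //; exact: bfun_cst.
  have h1 : F phi <= F (SS n) + e'.
    by apply: Fe => // w a ac; have := approx w a ac; rewrite ler_norml; lra.
  have h2 : F (SS n) <= F phi + e'.
    by apply: Fe => // w a ac; have := approx w a ac; rewrite ler_norml; lra.
  by rewrite ler_norml; apply/andP; split; lra.
have closeL := close L (fun f g _ bf _ bg => LD bf bg) L_cst
  (fun f g _ bf _ bg => L_le bf bg).
have closeM := close (fun f => M f) M_add M_cst quantile_law_le.
have l0 : l 0%N <= 1.
  rewrite -[leRHS](L_cst 1); apply: L_le; [exact: bfun_cut|exact: bfun_cst|].
  by move=> w a _; rewrite /cut mul1r lern1 leq_b1.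
have ln : 0 <= l n.
  rewrite -[leLHS](L_cst 0); apply: L_le; [exact: bfun_cst|exact: bfun_cut|].
  by move=> w a _; rewrite /cut mul1r.
have errn : `|L (SS n) - M (SS n)| <= 2 * e'.
  apply: (le_trans (err n (leqnn _))).
  have ll : l 0%N - l n <= 1 by move: (l 0%N) (l n) l0 ln => x y; lra.
  by rewrite ler_piMr// mulr_ge0.
have e'e : 4 * e' <= e.
  rewrite /e' /eta !mulrA ler_pdivrMr ?ltr0n// [leRHS]mulrC -ler_pdivrMr//.
  by rewrite ltW// truncnS_gt.
move: closeL closeM errn; rewrite !ler_norml; lra.
Qed.

End riesz.

(* A finitely additive law [L] with countably additive first marginal [P] is,
   on functions Lipschitz in the bounded second variable, a genuine law. *)
Theorem representation (R : realType) d (T : measurableType d)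
    (P : probability T R) (lo hi : R) (L : (T * R -> R) -> R) :
  lo < hi ->
  (forall f g, bfun f -> bfun g -> L (f + g) = L f + L g) ->
  (forall (a : R) f, bfun f -> L (a *: f) = a * L f) ->
  (forall f g, bfun f -> bfun g ->
    (forall w a, lo <= a <= hi -> f (w, a) <= g (w, a)) -> L f <= L g) ->
  (forall u, bmeas u -> L (u \o fst) = \int[P]_w u w) ->
  exists pi : probability (T * R)%type R,
    (forall B, measurable B -> pi (B `*` setT) = P B) /\
    (forall (phi : T * R -> R) (C : R), measurable_fun setT phi -> bfun phi ->
      (forall w a b, `|phi (w, a) - phi (w, b)| <= C * `|a - b|) ->
      \int[pi]_x phi x = L phi).
Proof.
move=> lohi LD LZ L_le L_fst.
pose U : probability (measurableTypeR R) R := uniform_prob (@ltr01 R).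
have mV : measurable_fun setT (idfun : measurableTypeR R -> R) by exact: measurable_id.
have V_unif (g : R) : 0 <= g <= 1 -> U [set u | idfun u < g] = g%:E.
  exact: uniform_prob_lt.
have /choice[G GP] := cut_density LD LZ L_le L_fst.
have mG c : measurable_fun setT (G c) by have [] := GP c.
have G01 c w : 0 <= G c w <= 1 by have [] := GP c.
have GE c A : measurable A -> L (cut \1_A c) = \int[P]_(w in A) G c w.
  by have [_ _] := GP c; exact.
exists (quantile_law P U mV lohi mG); split=> [B mB|phi C mphi bphi phiC].
  exact: quantile_law_fst.
exact: (quantile_law_lipschitz mV V_unif lohi LD LZ L_le L_fst mG G01 GE mphi bphi phiC).
Qed.

(** * Borel sets of separable normed spaces *)

Section separable.
Context (R : realType).

Definition separable (V : pseudoMetricType R) :=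
  exists s : nat -> V, forall x e, 0 < e -> exists n, ball x e (s n).

Lemma separable_real : separable R.
Proof.
exists (ratn R) => x e e0; have xe : x < x + e by rewrite ltrDl.
have [n /andP[xn ne]] := ratn_dense xe.
by exists n; rewrite /ball/= ltr_norml; lra.
Qed.

Lemma separable_matrix m n : separable 'M[R]_(m, n).
Proof.
pose s (k : nat) : 'M[R]_(m, n) :=
  if unpickle k is Some A then map_mx ratr (A : 'M[rat]_(m, n)) else 0.
exists s => x e e0.
have /choice[f fP] : forall ij : 'I_m * 'I_n, exists q : rat,
    x ij.1 ij.2 < ratr q < x ij.1 ij.2 + e.
  move=> ij; have /rat_in_itvoo[q] : x ij.1 ij.2 < x ij.1 ij.2 + e by rewrite ltrDl.
  by rewrite in_itv/= => qP; exists q.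
exists (pickle (\matrix_(i, j) f (i, j))); rewrite /s pickleK; split=> // i j.
rewrite !mxE; have := fP (i, j); rewrite /ball/= ltr_norml; lra.
Qed.

Lemma separable_prod (V1 V2 : pseudoMetricType R) :
  separable V1 -> separable V2 -> separable (V1 * V2)%type.
Proof.
move=> [s1 s1P] [s2 s2P].
exists (fun k => let ij := odflt (0, 0)%N (unpickle k) in (s1 ij.1, s2 ij.2)).
move=> [x1 x2] e e0; have [i xi] := s1P x1 e e0; have [j xj] := s2P x2 e e0.
by exists (pickle (i, j)); rewrite pickleK; split.
Qed.

Lemma separable_base (V : pseudoMetricType R) : separable V ->
  exists B : nat -> set V, (forall n, open (B n)) /\
    forall (O : set V) x, open O -> O x -> exists2 n, B n x & B n `<=` O.
Proof.
move=> [s sP].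
(* Interiors are taken because balls of a pseudometric structure need not be open. *)
pose B k := let nj := odflt (0, 0)%N (unpickle k) in
  (ball (s nj.1) (nj.2.+1%:R^-1))°.
exists B; split=> [k|O x oO Ox]; first exact: open_interior.
have /nbhs_ballP[e /= e0 eO] : nbhs x O by exact: open_nbhs_nbhs.
(* The radius 1 / (j + 1) is below e / 2. With a centre within half a radius of x, every point of
   the ball is within 3/2 of the radius of x, hence within e. *)
pose j := Num.truncn (2 / e).
have je : j.+1%:R^-1 * 2 < e :> R.
  rewrite mulrC ltr_pdivrMr ?ltr0n// mulrC -ltr_pdivrMr//; exact: truncnS_gt.
have j0 : 0 < j.+1%:R^-1 / 2 :> R by rewrite divr_gt0// invr_gt0 ltr0n.
have [n xn] := sP x _ j0.
exists (pickle (n, j)); rewrite /B pickleK/=.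
  apply/nbhs_ballP; exists (j.+1%:R^-1 / 2) => // y xy.
  by rewrite [_^-1]splitr; apply: ball_triangle xy; exact: ball_sym.
move=> y /interior_subset ny; apply: eO.
apply: (@le_ball _ _ _ (j.+1%:R^-1 / 2 + j.+1%:R^-1)); last exact: ball_triangle xn ny.
apply: ltW; apply: le_lt_trans je; move: j0; set z := _^-1; lra.
Qed.

End separable.

Section borel.
Context (R : realType).

Lemma borel_open (V : normedModType R) (O : set V) : open O ->
  measurable (O : set (borel V)).
Proof. exact: sub_sigma_algebra. Qed.

Lemma borel_closed (V : normedModType R) (F : set V) : closed F ->
  measurable (F : set (borel V)).
Proof. by move=> cF; rewrite -[F]setCK; apply: measurableC; apply: borel_open; exact: closed_openC. Qed.

Lemma borel_continuous (V : normedModType R) (f : V -> R) : continuous f ->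
  measurable_fun setT (f : borel V -> R).
Proof.
move=> cf; apply: (measurability _ (RGenOInfty.measurableE R)) => //.
move=> /= _ [_ [c ->] <-]; rewrite setTI; apply: borel_open.
by apply: open_comp => // x _; exact: cf.
Qed.

Lemma borel_continuousT d (T : measurableType d) (V : normedModType R)
    (f : T -> V) : (forall O, open O -> measurable (f @^-1` O)) ->
  measurable_fun setT (f : T -> borel V).
Proof.
move=> fO; apply: (@measurability _ _ T (borel V) setT f (@open V) erefl).
by move=> ? [ O oO <-]; rewrite setTI; exact: fO.
Qed.

Section support.
Context (V : normedModType R) (P : probability (borel V) R).
Variable B : nat -> set V.
Hypothesis oB : forall n, open (B n).
Hypothesis base : forall (O : set V) x, open O -> O x ->
  exists2 n, B n x & B n `<=` O.

(** The complement of the support is a union of null open sets, possibly uncountable; shrinking each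
    to a basic set makes it countable, hence null. *)
Let supportC : ~` msupport P = \bigcup_(n in [set n | P (B n) = 0%E]) B n.
Proof.
apply/seteqP; split=> [x|x [n /= Pn Bnx] sx]; last first.
  by have := sx _ (oB n) Bnx; rewrite Pn ltxx.
move=> /existsNP[ O /not_implyP[oO /not_implyP[Ox /negP]]].
rewrite -leNgt => PO; have [n Bx BO] := base oO Ox; exists n => //=.
apply/eqP; rewrite eq_le measure_ge0 andbT; apply: le_trans PO.
by apply: le_measure => //; rewrite inE; exact: borel_open.
Qed.

Lemma msupport_closed : closed (msupport P).
Proof.
by rewrite -[msupport P]setCK; apply: open_closedC; rewrite supportC; exact: bigcup_open.
Qed.

Lemma msupport_full : P (msupport P) = 1%E.
Proof.
have mS := borel_closed msupport_closed.
have S0 : P (~` msupport P) = 0%E.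
  apply: measure_negligible; first exact: measurableC.
  rewrite supportC [X in negligible _ X](_ : _ =
    \bigcup_n if P (B n) == 0%E then B n else set0).
    apply: negligible_bigcup => n; case: ifPn => [/eqP PB|_]; last exact: negligible_set0.
    by exists (B n); split=> //; exact: borel_open.
  apply/seteqP; split=> [x [n /= Pn Bx]|x [n _]].
    by exists n => //; rewrite Pn eqxx.
  by case: eqP => // Pn Bx; exists n.
by have := probability_setC P (measurableC mS); rewrite setCK S0 sube0.
Qed.

End support.

(** By separability every open set of the product is a countable union of open rectangles. This
    bridges the product sigma-algebra, where the law is constructed, and the Borel sets of the
    product topology, where [Theta_I] asks for it. *)
Lemma borel_prod (V : normedModType R) : separable V ->
  measurable_fun setT (idfun : (borel V * R)%type -> borel (V * R)%type).
Proof.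
move=> sV; have [B [oB Bbase]] := separable_base sV.
have [C [oC Cbase]] := separable_base (separable_real R).
apply: (@borel_continuousT _ (borel V * R)%type (V * R)%type idfun) => O oO.
have -> : idfun @^-1` O = \bigcup_n \bigcup_(m in [set m | B n `*` C m `<=` O]) (B n `*` C m).
  apply/seteqP; split=> [[x a] Oxa|[x a] [n _ [m /= BC BCxa]]]; last exact: BC.
  have [[ O1 O2] [/= nO1 nO2] O12] : nbhs (x, a) O by exact: open_nbhs_nbhs.
  have [n Bx Bn] := Bbase _ _ (open_interior O1) nO1.
  have [m Ca Cm] := Cbase _ _ (open_interior O2) nO2.
  exists n => //; exists m => //= -[y b] [/= By Cb]; apply: O12; split => /=.
  exact: interior_subset (Bn _ By).
  exact: interior_subset (Cm _ Cb).
apply: bigcup_measurable => n _; apply: bigcup_measurable => m _.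
apply: measurableX; first exact: borel_open.
exact: open_measurable.
Qed.

End borel.

(** * Inner regularity by closed sets *)

Section closed_regularity.
Context (R : realType) (V : normedModType R) (P : probability (borel V) R).

(** Approximation by closed sets from inside and open sets from outside together is stable under
    complement, which inner approximation alone is not. *)
Let regular := [set B : set V | measurable (B : set (borel V)) /\ forall e, 0 < e ->
  exists F O : set V, [/\ closed F, open O, F `<=` B, B `<=` O & (P (O `\` F) <= e%:E)%E]].

(** The closed inner sets are the complements of the neighbourhoods of radius 1 / (n + 1) of the
    complement of O; they exhaust O. *)
Let regular_open (O : set V) : open O -> regular O.
Proof.
move=> oO; split=> [|e e0]; first exact: borel_open.
pose G n := \bigcup_(y in ~` O) ball y n.+1%:R^-1.
have oG n : open (G n) by apply: bigcup_open => y _; exact: ball_open.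
have GO n : ~` G n `<=` O.
  move=> x; apply: contra_notP => nOx; exists x => //; apply: ballxx.
  by rewrite invr_gt0 ltr0n.
have cap0 : \bigcap_n (O `&` G n) = set0.
  apply/seteqP; split=> // x OG; have [Ox _] := OG 0%N I.
  have /nbhs_ballP[r /= r0 rO] : nbhs x O by exact: open_nbhs_nbhs.
  have [_ [y nOy yx]] := OG (Num.truncn r^-1) I; apply: nOy; apply: rO.
  apply: ball_sym; apply: le_ball yx.
  by rewrite -[leRHS]invrK lef_pV2 ?posrE ?invr_gt0 ?ltr0n// ltW// truncnS_gt.
have mOG n : measurable (O `&` G n : set (borel V)).
  by apply: measurableI; exact: borel_open.
have : P (O `&` G n) @[n --> \oo] --> 0%E.
  rewrite -(measure0 P) -cap0; apply: nonincreasing_cvg_mu => //.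
  - by rewrite ltey_eq fin_num_measure.
  - by rewrite cap0.
  - move=> i j ij; apply/subsetPset => x [Ox [y nOy yx]]; split=> //; exists y => //.
    by apply: le_ball yx; rewrite lef_pV2 ?posrE ?ltr0n// ler_nat ltnS.
move=> /fine_cvgP[_ /cvgrPdist_le /(_ e e0)[n _ /(_ n (leqnn _))]] /=.
rewrite sub0r normrN ger0_norm ?fine_ge0// => Pn.
exists (~` G n), O; split=> //; first exact: open_closedC.
rewrite setDE setCK -[leLHS]fineK ?lee_fin//.
by apply: fin_num_measure; exact: mOG.
Qed.

Let regularC B : regular B -> regular (~` B).
Proof.
move=> [mB rB]; split=> [|e e0]; first exact: measurableC.
have [F [ O [cF oO FB BO PO]]] := rB e e0; exists (~` O), (~` F); split.
- exact: open_closedC.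
- exact: closed_openC.
- exact: subsetC.
- exact: subsetC.
- by rewrite setDE setCK setIC -setDE.
Qed.

Let regular_bigcup (A : (set V)^nat) : (forall i, regular (A i)) ->
  regular (\bigcup_i A i).
Proof.
move=> rA; split=> [|e e0].
  by apply: (@bigcupT_measurable _ (borel V)) => i; have [] := rA i.
(* These tolerances sum to e / 2. The other half pays for keeping only finitely many closed sets, as
   a countable union of them need not be closed. *)
have e20 n : 0 < e / (2 ^ n.+2)%:R by rewrite divr_gt0// ltr0n expn_gt0.
have /choice[FO FOP] : forall n, exists FO : set V * set V,
    [/\ closed FO.1, open FO.2, FO.1 `<=` A n, A n `<=` FO.2 &
      (P (FO.2 `\` FO.1) <= (e / (2 ^ n.+2)%:R)%:E)%E].
  by move=> n; have [F [ O [? ? ? ? ?]]] := (rA n).2 _ (e20 n); exists (F, O).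
pose F n := (FO n).1; pose O n := (FO n).2.
have cF n : closed (F n) by have [] := FOP n.
have oO n : open (O n) by have [] := FOP n.
have FA n : F n `<=` A n by have [] := FOP n.
have AO n : A n `<=` O n by have [] := FOP n.
have PFO n : (P (O n `\` F n) <= (e / (2 ^ n.+2)%:R)%:E)%E by have [] := FOP n.
have mF n : measurable (F n : set (borel V)) by exact: borel_closed.
have mO n : measurable (O n : set (borel V)) by exact: borel_open.
pose G n := \big[setU/set0]_(i < n) F i.
have mG n : measurable (G n : set (borel V)).
  by apply: (@bigsetU_measurable _ (borel V)).
pose UF := \bigcup_i F i.
have mUF : measurable (UF : set (borel V)) by exact: (@bigcupT_measurable _ (borel V)).
have : P (UF `\` G n) @[n --> \oo] --> 0%E.
  have cap0 : \bigcap_n (UF `\` G n) = set0.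
    apply/seteqP; split=> // x UG; have [[i _ Fi] _] := UG 0%N I.
    have [_ nG] := UG i.+1 I; apply: nG.
    by rewrite /G -bigcup_mkord; exists i => /=.
  rewrite -(measure0 P) -cap0; apply: nonincreasing_cvg_mu => //.
  - by rewrite ltey_eq fin_num_measure//; exact: measurableD.
  - by move=> i; exact: measurableD.
  - by rewrite cap0.
  - move=> i j ij; apply/subsetPset; apply: setDS.
    rewrite /G -!bigcup_mkord => x [k /= ki Fk]; exists k => //=.
    exact: leq_trans ij.
have e2 : 0 < e / 2 by rewrite divr_gt0.
move=> /fine_cvgP[_ /cvgrPdist_le /(_ _ e2)[n _ /(_ n (leqnn _))]] /=.
rewrite sub0r normrN ger0_norm ?fine_ge0// => Pn.
exists (G n), (\bigcup_i O i); split.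
- by rewrite /G -bigcup_mkord; apply: closed_bigcup => //; exact: finite_II.
- exact: bigcup_open.
- by rewrite /G -bigcup_mkord => x [k _ Fk]; exists k => //; exact: FA.
- by move=> x [k _ Ak]; exists k => //; exact: AO.
have mOF : measurable (\bigcup_i (O i `\` F i) : set (borel V)).
  by apply: (@bigcupT_measurable _ (borel V)) => i; exact: measurableD.
apply: (@le_trans _ _ (P ((\bigcup_i (O i `\` F i)) `|` (UF `\` G n)))).
  apply: le_measure; rewrite ?inE.
  - by apply: measurableD => //; exact: (@bigcupT_measurable _ (borel V)).
  - by apply: measurableU => //; exact: measurableD.
  move=> x [[i _ Ox] nG]; have [Fx|nFx] := pselect (F i x).
    by right; split=> //; exists i.
  by left; exists i.
apply: (le_trans (measureU2 _ _ _)) => //; first exact: measurableD.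
rewrite [e in leRHS]splitr EFinD; apply: leeD; last first.
  by rewrite -[leLHS]fineK ?lee_fin// fin_num_measure//; exact: measurableD.
apply: (@le_trans _ _ (\sum_(0 <= i <oo) P (O i `\` F i))%E).
  by apply: measure_sigma_subadditive => // i; exact: measurableD.
apply: (@le_trans _ _ (\sum_(0 <= i <oo) (e / 2 / (2 ^ i.+1)%:R)%:E)%E).
  apply: lee_nneseries => [//|i _]; apply: (le_trans (PFO i)).
  by rewrite lee_fin -mulrA -invfM -natrM expnS.
apply: (le_trans (epsilon_trick0 _ _)) => //; exact: ltW.
Qed.

Lemma closed_inner_regular (B : set (borel V)) : measurable B ->
  forall e, 0 < e -> exists2 F : set V, closed F /\ F `<=` B & (P (B `\` F) <= e%:E)%E.
Proof.
move=> mB e e0; have rB : regular B.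
  have : <<s @open V >> `<=` regular.
    apply: smallest_sub; last by move=> O oO; exact: regular_open.
    split.
    - by have := regular_open open0.
    - by move=> A rA; rewrite setTD; exact: regularC.
    - exact: regular_bigcup.
  exact.
have [F [ O [cF oO FB BO PO]]] := rB.2 e e0; exists F => //.
apply: le_trans PO; apply: le_measure; rewrite ?inE.
- by apply: measurableD => //; exact: borel_closed.
- by apply: measurableD; [exact: borel_open|exact: borel_closed].
- exact: setSD.
Qed.

End closed_regularity.

(** * Cutoff functions and conditional probabilities *)

Section bump.
Context (R : realType) (V : normedModType R) (B : set V).

(** The element 1 keeps the set nonempty when [B] is empty; its infimum is the distance to [B]
    truncated at 1. *)
Let dset (x : V) := [set 1] `|` [set `|x - y| | y in B].

Let dset_lb x : lbound (dset x) 0.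
Proof. by move=> _ [->|[y _ <-]]. Qed.

Let dist (x : V) : R := inf (dset x).

Let dist_ge0 x : 0 <= dist x.
Proof. by apply: lb_le_inf; [exists 1; left|exact: dset_lb]. Qed.

Let dist_le x z : dset x z -> dist x <= z.
Proof. by move=> dz; apply: ge_inf => //; exists 0; exact: dset_lb. Qed.

Let dist_lip x x' : dist x <= dist x' + `|x - x'|.
Proof.
rewrite -lerBlDr; apply: lb_le_inf; first by exists 1; left.
move=> _ [->|[y By <-]]; rewrite lerBlDr.
  by apply: (@le_trans _ _ 1); [apply: dist_le; left|rewrite lerDl].
apply: (@le_trans _ _ `|x - y|); first by apply: dist_le; right; exists y.
rewrite [leRHS]addrC; apply: le_trans (ler_normD _ _).
by rewrite addrA subrK.
Qed.

Definition bump (n : nat) (x : V) : R := Num.max 0 (1 - n%:R * dist x).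

Lemma bump01 n x : 0 <= bump n x <= 1.
Proof.
rewrite /bump le_max lexx/= ge_max ler01/= gerBl.
by rewrite mulr_ge0.
Qed.

Lemma bump_lip n x x' : `|bump n x - bump n x'| <= n%:R * `|x - x'|.
Proof.
have n0 : 0 <= n%:R :> R by [].
have h1 : n%:R * dist x <= n%:R * dist x' + n%:R * `|x - x'|.
  by rewrite -mulrDr ler_wpM2l.
have h2 : n%:R * dist x' <= n%:R * dist x + n%:R * `|x - x'|.
  by rewrite -mulrDr ler_wpM2l// distrC.
have h3 : 0 <= n%:R * `|x - x'| by rewrite mulr_ge0.
rewrite /bump; case: (leP 0 (1 - n%:R * dist x)) => ?;
  case: (leP 0 (1 - n%:R * dist x')) => ?; rewrite ler_norml; lra.
Qed.

Lemma bump_continuous n : continuous (bump n).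
Proof.
move=> x; apply/cvgrPdist_le => e e0; near=> y.
apply: (le_trans (bump_lip _ _ _)).
apply: (@le_trans _ _ (n.+1%:R * (e / n.+1%:R))); last by rewrite mulrC divfK.
apply: ler_pM => //; first by rewrite ler_nat.
near: y; apply: cvgr_dist_le; [exact: cvg_id|by rewrite divr_gt0].
Unshelve. all: by end_near. Qed.

Lemma bump_cvg x : closed B -> bump n x @[n --> \oo] --> (\1_B x : R).
Proof.
move=> cB; have [Bx|nBx] := pselect (B x).
  rewrite indicE mem_set//=.
  have dx0 : dist x = 0.
    apply/eqP; rewrite eq_le dist_ge0 andbT; apply: dist_le; right; exists x => //.
    by rewrite subrr normr0.
  rewrite (_ : (fun n => _) = (fun=> 1)); first exact: cvg_cst.
  by apply/funext => n; rewrite /bump dx0 mulr0 subr0 max_r.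
rewrite indicE memNset//=.
have : nbhs x (~` B) by apply: open_nbhs_nbhs; split=> //; exact: closed_openC.
move=> /nbhs_ballP[e /= e0 eB].
pose e' := Num.min 1 e.
have e'0 : 0 < e' by rewrite lt_min ltr01 e0.
have dx : e' <= dist x.
  apply: lb_le_inf; first by exists 1; left.
  move=> _ [->|[y By <-]]; rewrite ge_min ?lexx//.
  apply/orP; right; rewrite leNgt; apply/negP => xy.
  by apply: (eB y) => //; rewrite -ball_normE.
apply: cvg_near_cst; exists (Num.truncn e'^-1).+1 => // n /= nn.
rewrite /bump max_l// subr_le0.
apply: (@le_trans _ _ (n%:R * e')); last by rewrite ler_wpM2l.
rewrite -ler_pdivrMr// mul1r ltW//; apply: lt_le_trans (truncnS_gt _) _.
by rewrite ler_nat.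
Qed.

End bump.

(** * Conditional probabilities as densities *)

Section conditional_probability.
Context (R : realType) d (O : measurableType d) d' (O' : measurableType d').
Context (mu : probability O R) (V : O -> O').
Hypothesis mV : measurable_fun setT V.

Let RV_V : {mfun O >-> O'} := mfun_Sub (mem_set mV).

Let law : probability O' R := distribution mu RV_V.

Let mVB (B : set O') : measurable B -> measurable (V @^-1` B).
Proof. by move=> mB; rewrite -[X in measurable X]setTI; exact: mV. Qed.

(** The content B |-> mu (E [&] V^-1 B) is dominated by the law of V. Its density h lives on the
    codomain, so h \o V is sigma(V)-measurable by construction, and a bound on every event of V
    becomes an almost sure bound on h. Existence and bounds come together because the bounds concern
    this particular version. *)
Lemma cond_prob_exists (E : set O) : measurable E ->
  exists g : O -> R, is_cond_prob mu V E g /\ forall q : R,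
    ((forall B, measurable B ->
       q * fine (mu (V @^-1` B)) <= fine (mu (E `&` V @^-1` B))) ->
     {ae mu, forall o, q <= g o}) /\
    ((forall B, measurable B ->
       fine (mu (E `&` V @^-1` B)) <= q * fine (mu (V @^-1` B))) ->
     {ae mu, forall o, g o <= q}).
Proof.
move=> mE.
have mEV B : measurable B -> measurable (E `&` V @^-1` B).
  by move=> mB; apply: measurableI => //; exact: mVB.
have [h [mh h01 hE]] := @dominated_content_density _ _ _ law
  (fun B => fine (mu (E `&` V @^-1` B))) (fun B => fine_ge0 (measure_ge0 _ _))
  ltac:(
    move=> A B mA mB /disj_set2P AB;
    rewrite preimage_setU setIUr measureU ?fineD ?fin_num_measure//;
    [exact: mEV|exact: mEV|exact: mEV|exact: mEV|
     by rewrite setIACA setIid -preimage_setI AB preimage_set0 setI0])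
  ltac:(
    move=> A mA; apply: fine_le; rewrite ?fin_num_measure//; [exact: mEV|];
    apply: le_measure; rewrite ?inE; [exact: mEV|exact: mVB|exact: subIsetr]).
have bh : bmeas h.
  by split=> //; exists 1 => x; have /andP[h0 h1] := h01 x; rewrite ger0_norm.
have mhV : measurable_fun setT (h \o V) by exact: measurableT_comp.
have bhV : bfun (h \o V) by exact: bfun_comp bh.2.
have int_hV B : measurable B ->
    (\int[mu]_(o in V @^-1` B) (h (V o))%:E = mu (E `&` V @^-1` B))%E.
  move=> mB; rewrite -[RHS]fineK ?fin_num_measure//; last exact: mEV.
  have := hE B mB => ->; rewrite /Rintegral fineK; last first.
    apply: integrable_fin_num => //; apply: bfun_integrable => //.
      exact: measurable_funTS.
    exact: bh.2.
  rewrite -[LHS](integral_pushforward mV (f := EFin \o h))//.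
  - exact/measurable_EFinP.
  - by apply: bfun_integrable => //; [exact: mVB|exact: measurable_funTS].
have hint : law.-integrable setT (EFin \o h) by exact: (bfun_integrable law measurableT mh bh.2).
have cint (q : R) : law.-integrable setT (EFin \o cst q).
  exact: (bfun_integrable law measurableT (measurable_cst q) (bfun_cst _ q)).
have cq (q : R) A : measurable A ->
    (\int[law]_(x in A) (cst q x)%:E = (q * fine (mu (V @^-1` A)))%:E)%E.
  move=> mA; transitivity (q%:E * law A)%E; first exact: (integral_cst law mA q%:E).
  rewrite EFinM fineK//.
  by apply: fin_num_measure; exact: mVB.
have hq A : measurable A ->
    (\int[law]_(x in A) (h x)%:E = (fine (mu (E `&` V @^-1` A)))%:E)%E.
  move=> mA; rewrite hE// /Rintegral fineK//; apply: integrable_fin_num => //.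
  exact: integrableS hint.
exists (h \o V); split=> [|q].
  split.
  - move=> _ Y mY; rewrite setTI comp_preimage; exists (h @^-1` Y); last by rewrite setTI.
    by rewrite -[X in measurable X]setTI; exact: mh.
  - exact: bfun_integrable.
  - by move=> _ [B mB <-]; rewrite setTI; exact: int_hV.
split=> hB.
  exists (V @^-1` [set x | h x < q]); split.
  - by apply: mVB; rewrite -[X in measurable X]setTI; exact: measurable_fun_ltr.
  - apply: (lt_set_null (mu := law) (f := cst q) (g := h)) => // A mA.
    by rewrite cq// hq// lee_fin hB.
  - by move=> o /= /negP; rewrite -ltNge.
exists (V @^-1` [set x | q < h x]); split.
- by apply: mVB; rewrite -[X in measurable X]setTI; exact: measurable_fun_ltr.
- apply: (lt_set_null (mu := law) (f := h) (g := cst q)) => // A mA.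
  by rewrite cq// hq// lee_fin hB.
- by move=> o /= /negP; rewrite -ltNge.
Qed.

End conditional_probability.

(** * Semicontinuity of the integrand *)

Section upper_semicontinuous.
Context (R : realType) (V : topologicalType) (D : set V).

Definition usc_on (f : V -> R) := forall v, D v -> forall e, 0 < e ->
  \forall v' \near v, D v' -> f v' <= f v + e.

Lemma usc_onD f g : usc_on f -> usc_on g -> usc_on (fun v => f v + g v).
Proof.
move=> uf ug v Dv e e0; have e2 : 0 < e / 2 by rewrite divr_gt0.
near=> v'.
have h1 : D v' -> f v' <= f v + e / 2 by near: v'; exact: uf.
have h2 : D v' -> g v' <= g v + e / 2 by near: v'; exact: ug.
move=> Dv'; have := h1 Dv'; have := h2 Dv'; lra.
Unshelve. all: by end_near. Qed.

Lemma usc_on_sum (I : Type) (s : seq I) (f : I -> V -> R) :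
  (forall i, usc_on (f i)) -> usc_on (fun v => \sum_(i <- s) f i v).
Proof.
move=> uf; elim: s => [|i s ih].
  by move=> v _ e e0; apply: filterE => v' _; rewrite !big_nil add0r ltW.
rewrite (_ : (fun v => _) = fun v => f i v + \sum_(i <- s) f i v); last first.
  by apply/funext => v; rewrite big_cons.
exact: usc_onD.
Qed.

Lemma usc_on_closed f c : closed D -> usc_on f -> closed [set v | D v /\ c <= f v].
Proof.
move=> cD uf v clv; have Dv : D v.
  by apply: cD; apply: closure_subset clv => x [].
split=> //; rewrite leNgt; apply/negP => fc.
have e0 : 0 < (c - f v) / 2 by rewrite divr_gt0// subr_gt0.
have [v' [[Dv' cv'] /(_ Dv')]] := clv _ (uf v Dv _ e0); lra.
Qed.

End upper_semicontinuous.

(** The set is the intersection over n of the projections of the superlevel sets of f at c -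
    1/(n+1). These are compact by semicontinuity, and compactness survives projection. The slack
    1/(n+1) allows for a supremum that is approached rather than attained. *)
Lemma usc_sup_ge (R : realType) (V : normedModType R) (W : set V) (K : set R)
    (f : V * R -> R) (c : R) :
  compact W -> compact K -> K !=set0 ->
  usc_on (W `*` K) f -> (exists M, forall w a, W w -> K a -> f (w, a) <= M) ->
  closed [set w | W w /\ c <= sup [set f (w, a) | a in K]].
Proof.
move=> cW cK K0 uf [M fM].
have cWK : compact (W `*` K) by exact: compact_setX.
have clWK : closed (W `*` K) by apply: compact_closed => //; exact: norm_hausdorff.
have -> : [set w | W w /\ c <= sup [set f (w, a) | a in K]] =
    \bigcap_n (fst @` [set v | (W `*` K) v /\ c - n.+1%:R^-1 <= f v]).
  apply/seteqP; split=> [w [Ww cw] n _|w wn].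
    have n0 : 0 < n.+1%:R^-1 :> R by rewrite invr_gt0 ltr0n.
    have /sup_gt[|_ [a Ka <-] fa] : c - n.+1%:R^-1 < sup [set f (w, a) | a in K].
      by apply: lt_le_trans cw; rewrite ltrBlDr ltrDl.
    - by case: K0 => a Ka; exists (f (w, a)), a.
    - by exists (w, a) => //=; split=> //; exact: ltW.
  have [[w' a'] [[/= Ww' _] _] ww'] := wn 0%N I.
  split; first by rewrite -ww'.
  apply/ler_addgt0Pl => e e0.
  have [[w2 a2] [[/= Ww2 Ka2] ca] w2w] := wn (Num.truncn e^-1) I.
  rewrite /= in w2w; subst w2.
  have le : (Num.truncn e^-1).+1%:R^-1 <= e.
    by rewrite -[leRHS]invrK lef_pV2 ?posrE ?invr_gt0 ?ltr0n// ltW// truncnS_gt.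
  have fs : f (w, a2) <= sup [set f (w, a) | a in K].
    apply: ub_le_sup; last by exists a2.
    by exists M => _ [a Ka <-]; exact: fM.
  by move: ca; set z := _^-1 in le *; lra.
apply: closed_bigI => n _; apply: compact_closed; first exact: norm_hausdorff.
apply: continuous_compact.
  by apply: continuous_subspaceT => x; exact: cvg_fst.
apply: (subclosed_compact _ cWK); last by move=> v [].
exact: usc_on_closed.
Qed.

(** Semicontinuity of a product in numbers: x and c are the multiplier and coefficient at a point, y
    and c' those nearby. The multiplier moves by at most e, while the coefficient can only drop,
    which lowers the product as y >= 0. *)
Lemma ler_mul_perturb (R : realType) (x y e c c' : R) : 0 <= y -> `|x - y| <= e ->
  c' <= c -> -1 <= c <= 1 -> y * c' <= x * c + e.
Proof.
move=> y0 xye cc' c1; apply: (le_trans (ler_wpM2l y0 cc')).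
rewrite -lerBlDl -mulrBl; apply: (le_trans (ler_norm _)).
by rewrite normrM distrC -[leRHS]mulr1 ler_pM// ler_norml.
Qed.

(** * The model variables on a compact support *)

Section model_facts.
Context (R : realType) (T k : nat).
Implicit Types (P : probability (borel (obs R T k)) R) (th : param R k).

Lemma separable_obs : separable (obs R T k : pseudoMetricType R).
Proof. exact: separable_prod (@separable_matrix R T 1) (@separable_matrix R T k). Qed.

Lemma msupport_obs P : closed (msupport P) /\ P (msupport P) = 1%E.
Proof.
have [B [oB base]] := separable_base separable_obs.
split; first exact: (@msupport_closed R (obs R T k) P B).
exact: (@msupport_full R (obs R T k) P B).
Qed.

Lemma Z_continuous th l t : continuous (Z th l t : obs R T k -> R).
Proof.
have c1 : continuous (fun w : obs R T k => w.1 t ord0).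
  move=> w; apply: (@continuous_comp _ _ _ fst (fun M : 'cV[R]_T => M t ord0)).
    exact: cvg_fst.
  exact: coord_continuous.
have c2 (b : 'cV[R]_k) : continuous (fun w : obs R T k => (row t w.2 *m b) ord0 ord0).
  have -> : (fun w : obs R T k => (row t w.2 *m b) ord0 ord0) =
            (fun w => \sum_j w.2 t j * b j ord0).
    by apply/funext => w; rewrite mxE; apply: eq_bigr => j _; rewrite mxE.
  apply: continuous_big => [z|j _ w].
    by apply: cvgD; [exact: cvg_fst|exact: cvg_snd].
  apply: cvgM; last exact: cvg_cst.
  apply: (@continuous_comp _ _ _ snd (fun M : 'M[R]_(T, k) => M t j)).
    exact: cvg_snd.
  exact: coord_continuous.
case: th => [[b0 b1] r] w; rewrite /Z; case: (l == ord0).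
  by apply: cvgB; [exact: c1|exact: c2].
by apply: cvgM; [apply: cvgB; [exact: c1|exact: c2]|exact: cvg_cst].
Qed.

Lemma Z_fst_continuous th l t : continuous (fun v : obsA R T k => Z th l t v.1).
Proof.
move=> x; apply: (@continuous_comp (obsA R T k) (obs R T k) R fst (Z th l t)).
  exact: cvg_fst.
exact: Z_continuous.
Qed.

Lemma covlat_continuous : continuous (fun v : obsA R T k => (v.1.2, v.2) : covA R T k).
Proof.
move=> x.
have h1 : v.1.2 @[v --> x] --> x.1.2.
  by apply: (@continuous_comp _ _ _ fst snd); [exact: cvg_fst|exact: cvg_snd].
have h2 : v.2 @[v --> x] --> x.2 by exact: cvg_snd.
exact: (cvg_pair h1 h2).
Qed.

Lemma msupport_nonempty P : msupport P !=set0.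
Proof.
apply/set0P/negP => /eqP S0; have [_] := msupport_obs P.
by rewrite S0 measure0 => /eqP; rewrite eq_sym onee_eq0.
Qed.

Section compact_support.
Context (th : param R k) (P : probability (borel (obs R T k)) R).
Hypothesis hT : (1 <= T)%N.
Hypothesis cP : compact (msupport P).

Local Notation lo := (inf (Z_values th P)).
Local Notation hi := (sup (Z_values th P)).

Lemma Z_bounds l t w : msupport P w -> lo <= Z th l t w <= hi.
Proof.
have bd l' t' : exists M, forall w, msupport P w -> `|Z th l' t' w| <= M.
  have : compact (Z th l' t' @` msupport P).
    by apply: continuous_compact => //; apply: continuous_subspaceT; exact: Z_continuous.
  move=> /compact_bounded[M [_ /(_ (M + 1))]].
  rewrite ltrDl ltr01 => /(_ isT) h; exists (M + 1) => v Pv.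
  by apply: h; exists v.
have /choice[M MP] : forall lt : 'I_2 * 'I_T, exists M, forall w, msupport P w ->
    `|Z th lt.1 lt.2 w| <= M by move=> lt; exact: bd.
(* The sum of the absolute bounds is a common bound for the finitely many pairs (l, t); without
   boundedness the real [inf] and [sup] would carry no information. *)
have ub : forall z, Z_values th P z -> `|z| <= \sum_lt `|M lt|.
  move=> z [l' [t' [v [Pv ->]]]].
  rewrite (bigD1 (l', t'))//=; apply: (le_trans (MP (l', t') v Pv)).
  by apply: (le_trans (ler_norm _)); rewrite lerDl sumr_ge0.
move=> Pw; have Zw : Z_values th P (Z th l t w) by exists l, t, w.
apply/andP; split.
  apply: ge_inf => //; exists (- \sum_lt `|M lt|) => z /ub.
  by rewrite ler_norml => /andP[].
apply: ub_le_sup => //; exists (\sum_lt `|M lt|) => z /ub.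
by rewrite ler_norml => /andP[].
Qed.

Lemma K_theta_nonempty : K_theta th P !=set0.
Proof.
have [w Pw] := msupport_nonempty P.
have /andP[lZ Zh] := Z_bounds ord0 (Ordinal hT) Pw.
by exists lo; rewrite /K_theta/= in_itv/= lexx (le_trans lZ Zh).
Qed.

Lemma K_theta_le : lo <= hi.
Proof.
have [a] := K_theta_nonempty; rewrite /K_theta/= in_itv/= => /andP[].
exact: le_trans.
Qed.

Lemma X_supp_compact : compact (X_supp P).
Proof.
apply: continuous_compact => //; apply: continuous_subspaceT => x; exact: cvg_snd.
Qed.

Lemma XK_compact : compact (X_supp P `*` K_theta th P).
Proof. by apply: compact_setX; [exact: X_supp_compact|exact: segment_compact]. Qed.

Variable tau : R.
Hypothesis htau : 0 < tau < 1.

Lemma q_bounds l : 0 < q tau l < 1.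
Proof. by rewrite /q; case: ifP => // _; lra. Qed.

Variable lam : multiplier R T k.
Hypothesis alam : admissible th P lam.

Lemma cont_nonneg_bounded (f : covA R T k -> R) : cont_nonneg (X_supp P `*` K_theta th P) f ->
  exists2 M : R, 0 <= M & forall v, (X_supp P `*` K_theta th P) v -> 0 <= f v <= M.
Proof.
move=> [cf f0]; have := continuous_compact cf XK_compact.
move=> /compact_bounded[M [_ /(_ (Num.max 0 M + 1))]].
rewrite (le_lt_trans (y := Num.max 0 M))//; last 2 first.
- by rewrite le_max lexx orbT.
- by rewrite ltrDl.
move=> /(_ isT) h; exists (Num.max 0 M + 1); first by rewrite addr_ge0// le_max lexx.
by move=> v Dv; rewrite f0//= -[leLHS]ger0_norm ?f0//; apply: h; exists v.
Qed.

Local Notation D := (msupport P `*` K_theta th P).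

Let near_cov (f : covA R T k -> R) (v : obsA R T k) (e : R) : cont_nonneg (X_supp P `*` K_theta th P) f ->
  D v -> 0 < e ->
  \forall v' \near v, D v' -> `|f (v.1.2, v.2) - f (v'.1.2, v'.2)| <= e.
Proof.
move=> [cf _] [Wv Kv] e0.
have XKv : (X_supp P `*` K_theta th P) (v.1.2, v.2) by split=> //; exists v.1.
have /subspace_continuousP/(_ _ XKv)/cvgrPdist_le/(_ e e0) h := cf.
apply: (filterS _ (covlat_continuous h : nbhs v _)) => v' /= h' [Wv' Kv']; apply: h'.
by split=> //; exists v'.1.
Qed.

(** Where Z <= a the coefficient already has its largest value and can only drop nearby; where Z > a
    the strict inequality persists in a neighbourhood, so the coefficient is locally constant. *)
Let usc_minus (f : covA R T k -> R) l t : cont_nonneg (X_supp P `*` K_theta th P) f ->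
  usc_on D (fun v : obsA R T k => f (v.1.2, v.2) * ((Z th l t v.1 <= v.2)%R%:R - q tau l)).
Proof.
move=> cf v Dv e e0; have /andP[q0 q1] := q_bounds l.
have f0 v' : D v' -> 0 <= f (v'.1.2, v'.2).
  by move=> [Wv' Kv']; apply: cf.2; split=> //; exists v'.1.
have cZ := @Z_fst_continuous th l t.
have nf := near_cov cf Dv e0.
have [Zv|Zv] := leP (Z th l t v.1) v.2.
  near=> v'.
  have nfv' : D v' -> `|f (v.1.2, v.2) - f (v'.1.2, v'.2)| <= e by near: v'.
  move=> Dv'; have fv' := nfv' Dv'.
  apply: ler_mul_perturb fv' _ _; first exact: f0.
    by rewrite lerB// lern1 leq_b1.
  by rewrite /=; lra.
have hc : (fun v => Z th l t v.1 - v.2) v @[v --> v] --> Z th l t v.1 - v.2 by apply: cvgB; [exact: cZ|exact: cvg_snd].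
near=> v'.
have nfv' : D v' -> `|f (v.1.2, v.2) - f (v'.1.2, v'.2)| <= e by near: v'.
have Zv' : v'.2 < Z th l t v'.1.
  near: v'; move/cvgrPdist_lt : hc => /(_ (Z th l t v.1 - v.2)); rewrite subr_gt0 => /(_ Zv).
  by apply: filterS => v'; rewrite ltr_norml; lra.
move=> Dv'; have fv' := nfv' Dv'; rewrite [Z th l t v'.1 <= _]leNgt Zv'/= !sub0r.
by apply: ler_mul_perturb fv' _ _; [exact: f0|exact: lexx|rewrite /=; lra].
Unshelve. all: by end_near. Qed.

(** The mirror case: {Z < a} is open and its indicator enters with a minus sign. *)
Let usc_plus (f : covA R T k -> R) l t : cont_nonneg (X_supp P `*` K_theta th P) f ->
  usc_on D (fun v : obsA R T k => f (v.1.2, v.2) * (q tau l - (Z th l t v.1 < v.2)%R%:R)).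
Proof.
move=> cf v Dv e e0; have /andP[q0 q1] := q_bounds l.
have f0 v' : D v' -> 0 <= f (v'.1.2, v'.2).
  by move=> [Wv' Kv']; apply: cf.2; split=> //; exists v'.1.
have cZ := @Z_fst_continuous th l t.
have nf := near_cov cf Dv e0.
have [Zv|Zv] := leP v.2 (Z th l t v.1).
  near=> v'.
  have nfv' : D v' -> `|f (v.1.2, v.2) - f (v'.1.2, v'.2)| <= e by near: v'.
  move=> Dv'; have fv' := nfv' Dv'.
  apply: ler_mul_perturb fv' _ _; first exact: f0.
    by rewrite lerB.
  by rewrite /=; lra.
have hc : (fun v => v.2 - Z th l t v.1) v @[v --> v] --> v.2 - Z th l t v.1 by apply: cvgB; [exact: cvg_snd|exact: cZ].
near=> v'.
have nfv' : D v' -> `|f (v.1.2, v.2) - f (v'.1.2, v'.2)| <= e by near: v'.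
have Zv' : Z th l t v'.1 < v'.2.
  near: v'; move/cvgrPdist_lt : hc => /(_ (v.2 - Z th l t v.1)); rewrite subr_gt0 => /(_ Zv).
  by apply: filterS => v'; rewrite ltr_norml; lra.
move=> Dv'; have fv' := nfv' Dv'; rewrite Zv'/=.
by apply: ler_mul_perturb fv' _ _; [exact: f0|exact: lexx|rewrite /=; lra].
Unshelve. all: by end_near. Qed.

Lemma S_theta_usc : usc_on D (fun v : obsA R T k => S_theta tau th lam v.1 v.2).
Proof.
apply: usc_on_sum => l; apply: usc_on_sum => t; have [lm lp] := alam l t.
by apply: usc_onD; [exact: usc_minus|exact: usc_plus].
Qed.

Lemma S_theta_bounded : exists M, forall w a, msupport P w -> K_theta th P a ->
  `|S_theta tau th lam w a| <= M.
Proof.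
have /choice[M MP] : forall lt : 'I_2 * 'I_T, exists M, forall v, (X_supp P `*` K_theta th P) v ->
    0 <= lam_minus lam lt.1 lt.2 v <= M /\ 0 <= lam_plus lam lt.1 lt.2 v <= M.
  move=> [l t]; have [lm lp] := alam l t.
  have [M1 M10 h1] := cont_nonneg_bounded lm; have [M2 M20 h2] := cont_nonneg_bounded lp.
  exists (M1 + M2) => v Dv; have /andP[-> a1] := h1 v Dv; have /andP[-> a2] := h2 v Dv.
  by split; lra.
exists (\sum_(l < 2) \sum_(t < T) 2 * M (l, t)) => w a Ww Ka.
rewrite /S_theta; apply: (le_trans (ler_norm_sum _ _ _)); apply: ler_sum => l _.
apply: (le_trans (ler_norm_sum _ _ _)); apply: ler_sum => t _.
have [|/andP[m0 m1] /andP[p0 p1]] := MP (l, t) (w.2, a).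
  by split=> //; exists w.
have /andP[q0 q1] := q_bounds l; rewrite /= in m0 m1 p0 p1.
apply: (le_trans (ler_normD _ _)); rewrite mulr_natl mulr2n.
apply: lerD; rewrite normrM -[leRHS]mulr1; apply: ler_pM => //.
- by rewrite ger0_norm.
- by rewrite ler_norml; case: (Z _ _ _ _ <= _) => /=; lra.
- by rewrite ger0_norm.
- by rewrite ler_norml; case: (Z _ _ _ _ < _) => /=; lra.
Qed.

Definition S_sup (w : obs R T k) : R :=
  sup [set S_theta tau th lam w a | a in K_theta th P].

Lemma S_sup_ge w a : msupport P w -> K_theta th P a -> S_theta tau th lam w a <= S_sup w.
Proof.
move=> Ww Ka; have [M SM] := S_theta_bounded; apply: ub_le_sup; last by exists a.
by exists M => _ [b Kb <-]; have := SM w b Ww Kb; rewrite ler_norml => /andP[].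
Qed.

Lemma S_sup_le w c : (forall a, K_theta th P a -> S_theta tau th lam w a <= c) ->
  S_sup w <= c.
Proof.
move=> Sc; apply: ge_sup; last by move=> _ [a Ka <-]; exact: Sc.
by have [a Ka] := K_theta_nonempty; exists (S_theta tau th lam w a), a.
Qed.

Lemma S_sup_bounded : exists M, forall w, msupport P w -> `|S_sup w| <= M.
Proof.
have [M SM] := S_theta_bounded; exists M => w Ww; rewrite ler_norml; apply/andP; split.
  have [a Ka] := K_theta_nonempty; apply: le_trans (S_sup_ge Ww Ka).
  by have := SM w a Ww Ka; rewrite ler_norml => /andP[].
apply: S_sup_le => a Ka.
by have := SM w a Ww Ka; rewrite ler_norml => /andP[].
Qed.

Lemma S_sup_measurable : measurable_fun (msupport P : set (borel (obs R T k))) S_sup.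
Proof.
apply: (measurability _ (RGenCInfty.measurableE R)).
move=> _ [_ [c ->] <-].
have -> : msupport P `&` S_sup @^-1` `[c, +oo[%classic = [set w | msupport P w /\ c <= S_sup w].
  by apply/seteqP; split=> w /=; rewrite in_itv/= andbT.
apply: borel_closed; have [M SM] := S_theta_bounded.
apply: (@usc_sup_ge R (obs R T k) _ _ (fun v => S_theta tau th lam v.1 v.2)) => //.
- exact: segment_compact.
- exact: K_theta_nonempty.
- exact: S_theta_usc.
- by exists M => w a Ww Ka; have := SM w a Ww Ka; rewrite ler_norml => /andP[].
Qed.

End compact_support.

End model_facts.

(** * The functional dual to the multipliers *)

Section dual_functional.
Context (R : realType) (T k : nat).
Variables (th : param R k) (P : probability (borel (obs R T k)) R) (tau : R).
Hypotheses (hT : (1 <= T)%N) (cP : compact (msupport P)) (htau : 0 < tau < 1).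

Local Notation lo := (inf (Z_values th P)).
Local Notation hi := (sup (Z_values th P)).

(** Global continuity and boundedness put the resulting [S_theta] in the domain of [upint], made of
    bounded functions on the whole space. The cutoffs used as tests are of this kind. *)
Definition tame (f : covA R T k -> R) := [/\ continuous f, bfun f & forall v, 0 <= f v].

Definition tame_multiplier (lam : multiplier R T k) := forall l t,
  tame (lam_minus lam l t) /\ tame (lam_plus lam l t).

Lemma tame_admissible lam : tame_multiplier lam -> admissible th P lam.
Proof.
move=> tl l t; have [[cm _ m0] [cp _ p0]] := tl l t.
by split; split=> //; exact: continuous_subspaceT.
Qed.

Lemma tameD f g : tame f -> tame g -> tame (f \+ g).
Proof.
move=> [cf bf f0] [cg bg g0]; split; [|exact: bfunD|by move=> v; exact: addr_ge0].
by move=> v; apply: cvgD; [exact: cf|exact: cg].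
Qed.

Lemma tameZ (a : R) f : 0 <= a -> tame f -> tame (fun v => a * f v).
Proof.
move=> a0 [cf bf f0]; split; [|exact: (bfunZ a bf)|by move=> v; exact: mulr_ge0].
by move=> v; apply: cvgM; [exact: cvg_cst|exact: cf].
Qed.

Lemma tame0 : tame (fun=> 0).
Proof. by split=> // v; exact: cvg_cst. Qed.

Definition multD (lam lam' : multiplier R T k) := Multiplier
  (fun l t => lam_minus lam l t \+ lam_minus lam' l t)
  (fun l t => lam_plus lam l t \+ lam_plus lam' l t).

Definition multZ (a : R) (lam : multiplier R T k) := Multiplier
  (fun l t v => a * lam_minus lam l t v) (fun l t v => a * lam_plus lam l t v).

Lemma S_thetaD lam lam' w a :
  S_theta tau th (multD lam lam') w a = S_theta tau th lam w a + S_theta tau th lam' w a.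
Proof.
rewrite /S_theta -big_split; apply: eq_bigr => l _; rewrite -big_split.
by apply: eq_bigr => t _ /=; ring.
Qed.

Lemma S_thetaZ c lam w a :
  S_theta tau th (multZ c lam) w a = c * S_theta tau th lam w a.
Proof.
rewrite /S_theta mulr_sumr; apply: eq_bigr => l _; rewrite mulr_sumr.
by apply: eq_bigr => t _ /=; ring.
Qed.

(** Activating one pair of multipliers at a time splits nonnegativity on the cone into a separate
    inequality for each (l, t). *)
Definition mult1 (l0 : 'I_2) (t0 : 'I_T) (f g : covA R T k -> R) := Multiplier
  (fun l t v => ((l == l0) && (t == t0))%:R * f v)
  (fun l t v => ((l == l0) && (t == t0))%:R * g v).

Lemma tame_mult1 l t f g : tame f -> tame g -> tame_multiplier (mult1 l t f g).
Proof. by move=> tf tg l' t'; split; apply: tameZ. Qed.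

Lemma S_theta1 l t f g w a : S_theta tau th (mult1 l t f g) w a =
  f (w.2, a) * ((Z th l t w <= a)%R%:R - q tau l) +
  g (w.2, a) * (q tau l - (Z th l t w < a)%R%:R).
Proof.
rewrite /S_theta (bigD1 l)//= (bigD1 t)//= !eqxx/= !mul1r !big1 ?addr0//.
- by move=> l' /negPf l'l; apply: big1 => t' _; rewrite l'l/= !mul0r addr0.
- by move=> t' /negPf ->; rewrite ?andbF !mul0r addr0.
Qed.

Lemma tame_S_bounded lam : tame_multiplier lam ->
  bfun (fun v : obs R T k * R => S_theta tau th lam v.1 v.2).
Proof.
move=> tl; have bsum (I : Type) (s : seq I) (F : I -> obs R T k * R -> R) :
    (forall i, bfun (F i)) -> bfun (fun v => \sum_(i <- s) F i v).
  move=> bF; elim: s => [|i s ih].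
    by exists 0 => v; rewrite big_nil normr0.
  rewrite (_ : (fun v => _) = F i + (fun v => \sum_(i <- s) F i v)).
    exact: bfunD.
  by apply/funext => v; rewrite big_cons.
apply: (@bsum _ _ _) => l; apply: (@bsum _ _ _) => t; have [[_ bm _] [_ bp _]] := tl l t.
have b1 : bfun (fun v : obs R T k * R => (Z th l t v.1 <= v.2)%R%:R - q tau l).
  exact: (bfunD (bfun_bool _ _) (bfun_cst _ _)).
have b2 : bfun (fun v : obs R T k * R => q tau l - (Z th l t v.1 < v.2)%R%:R).
  have := bfunD (bfun_cst _ (q tau l)) (bfunZ (-1) (bfun_bool R
    (fun v : obs R T k * R => (Z th l t v.1 < v.2)%R))).
  congr bfun; apply/funext => v.
  by transitivity (q tau l + -1 * (Z th l t v.1 < v.2)%R%:R); [|rewrite mulN1r].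
exact: bfunD (bfunM (bfun_comp (fun v : obs R T k * R => (v.1.2, v.2)) bm) b1)
  (bfunM (bfun_comp (fun v : obs R T k * R => (v.1.2, v.2)) bp) b2).
Qed.

(** Monotonicity is stated on the interval up to hi + 1: [K_theta] may reduce to a point, whereas
    the later grid needs an interval of positive length. A premise on the larger interval implies
    the one on [K_theta]. *)
Lemma dual_functional :
  (forall lam, admissible th P lam -> (0 <= Psi tau P th lam)%E) ->
  exists L : (borel (obs R T k) * R -> R) -> R,
    [/\ forall f g, bfun f -> bfun g -> L (f + g) = L f + L g,
        forall (a : R) f, bfun f -> L (a *: f) = a * L f,
        forall f g, bfun f -> bfun g ->
          (forall w a, lo <= a <= hi + 1 -> f (w, a) <= g (w, a)) -> L f <= L g,
        forall u, bmeas u -> L (u \o fst) = \int[P]_w u w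
      & forall l t f g, tame f -> tame g ->
          0 <= L (fun v => f (v.1.2, v.2) * ((Z th l t v.1 <= v.2)%R%:R - q tau l) +
                           g (v.1.2, v.2) * (q tau l - (Z th l t v.1 < v.2)%R%:R))].
Proof.
move=> H.
have [clW PW] := msupport_obs P.
have mW : measurable (msupport P : set (borel (obs R T k))) by exact: borel_closed.
have K0 : K_theta th P !=set0 by exact: K_theta_nonempty.
pose C := [set g : borel (obs R T k) * R -> R | exists2 lam, tame_multiplier lam &
  g = fun v => S_theta tau th lam v.1 v.2].
have [|||||L [LD LZ L_le L_fst LC]] := @upint_minorant_cone R _ (borel (obs R T k)) R P
  (msupport P) (K_theta th P) mW PW K0 C.
- by move=> _ [lam tl ->]; exact: tame_S_bounded.
- exists (mult1 ord0 (Ordinal hT) (fun=> 0) (fun=> 0)).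
    by apply: tame_mult1; exact: tame0.
  by apply/funext => v; rewrite S_theta1 !mul0r addr0.
- move=> _ _ [lam tl ->] [lam' tl' ->]; exists (multD lam lam').
    by move=> l t; split; apply: tameD; have [] := tl l t; have [] := tl' l t.
  by apply/funext => v; rewrite S_thetaD.
- move=> a _ a0 [lam tl ->]; exists (multZ a lam).
    by move=> l t; split; apply: tameZ => //; have [] := tl l t.
  by apply/funext => v; rewrite S_thetaZ.
(* Any measurable majorant of S_theta over all a dominates the integrand of [Psi] on the support, so
   [Psi] is a lower bound for the upper integral. *)
- move=> _ [lam tl ->]; apply: upint_ge => //; first exact: tame_S_bounded.
  move=> u mu bu Su; have alam := tame_admissible tl.
  have iu : P.-integrable (msupport P) (EFin \o u) by exact: bfun_integrable.
  have Pp := H lam alam.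
  rewrite -lee_fin; apply: (le_trans Pp); rewrite /Psi /Rintegral fineK; last first.
    exact: integrable_fin_num.
  have [M SM] := S_sup_bounded hT cP htau alam.
  apply: le_integral => //.
    apply: measurable_bounded_integrable => //.
    - by rewrite ltey_eq fin_num_measure.
    - exact: (S_sup_measurable hT cP htau alam).
    - exists M; split; first exact: num_real.
      by move=> N MN w Ww; apply: le_trans (ltW MN); exact: SM.
  move=> w; rewrite inE => Ww; rewrite lee_fin.
  apply: (S_sup_le hT cP) => a Ka.
  exact: Su.
exists L; split=> //.
- move=> f g bf bg fg; apply: L_le => // w a Ww; rewrite /K_theta/= in_itv/= => /andP[la ah].
  by apply: fg; rewrite la (le_trans ah)// lerDl.
- move=> u [mu bu]; rewrite L_fst//; last exact: measurable_funTS.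
  congr fine; have iu : P.-integrable setT (EFin \o u) by exact: bfun_integrable.
  have mC := measurableC mW.
  rewrite [RHS](negligible_integral mC measurableT iu).
    by rewrite setTD setCK.
  have := probability_setC P mW; rewrite PW subee//.
- move=> l t f g tf tg; apply: LC; exists (mult1 l t f g); first exact: tame_mult1.
  by apply/funext => v; rewrite S_theta1.
Qed.

End dual_functional.

(** * From closed events to Borel events *)

Lemma Rint_indicM (R : realType) d (T : measurableType d) (mu : probability T R)
    (A E : set T) : measurable A -> measurable E ->
  \int[mu]_x (\1_A x * \1_E x) = fine (mu (E `&` A)).
Proof.
move=> mA mE; transitivity (\int[mu]_x \1_(E `&` A) x).
  by apply: eq_Rintegral => x _; rewrite !indicE in_setI -natrM mulnb andbC.
by rewrite /Rintegral integral_indic ?setIT//; exact: measurableI.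
Qed.

Lemma Rint_indic_sub (R : realType) d (T : measurableType d) (mu : probability T R)
    (A E : set T) (c : R) : measurable A -> measurable E ->
  \int[mu]_x (\1_A x * (\1_E x - c)) = fine (mu (E `&` A)) - c * fine (mu A).
Proof.
move=> mA mE; have ind B : measurable B -> bmeas (\1_B : T -> R).
  by move=> mB; exact: bmeas_indic.
rewrite -Rint_indicM//.
have -> : fine (mu A) = \int[mu]_x \1_A x by rewrite /Rintegral integral_indic ?setIT.
have i1 : mu.-integrable setT (EFin \o \1_A) by apply: bmeas_integrable => //; exact: ind.
have bAE : bmeas (fun x => \1_A x * \1_E x : R).
  by split; [apply: measurable_funM; exact: measurable_indic|apply: bfunM; exact: bfun_bool].
have bcA : bmeas (fun x => c * \1_A x : R).
  by split; [apply: measurable_funM => //; exact: measurable_indic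
            |apply: bfunM; [exact: bfun_cst|exact: bfun_bool]].
rewrite -RintegralZl// -RintegralB//; try exact: bmeas_integrable.
by apply: eq_Rintegral => x _; rewrite mulrBr [_ * c]mulrC.
Qed.

Section ramp.
Context (R : realType).

Definition ramp (s : R) : R := Num.min 1 (Num.max 0 s).

Lemma ramp01 s : 0 <= ramp s <= 1.
Proof. by rewrite /ramp le_min ler01 le_max lexx/= ge_min lexx. Qed.

Lemma ramp_ge1 s : 1 <= s -> ramp s = 1.
Proof. by move=> s1; rewrite /ramp min_l// le_max s1 orbT. Qed.

Lemma ramp_le0 s : s <= 0 -> ramp s = 0.
Proof. by move=> s0; rewrite /ramp max_l// min_r. Qed.

Lemma ramp_lip s s' : `|ramp s - ramp s'| <= `|s - s'|.
Proof.
rewrite /ramp; case: (leP 0 s) => ?; case: (leP 0 s') => ?;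
  rewrite ?[Num.min 1 0]min_r//; try (case: (leP 1 s) => ?);
  try (case: (leP 1 s') => ?); rewrite ler_norml; apply/andP; split;
  (have [h|h] := lerP 0 (s - s'); [rewrite ger0_norm//|rewrite ltr0_norm//]); lra.
Qed.

Lemma ramp_continuous : continuous ramp.
Proof.
move=> s; apply/cvgrPdist_le => e e0; near=> s'.
apply: (le_trans (ramp_lip _ _)).
near: s'; apply: cvgr_dist_le => //; exact: cvg_id.
Unshelve. all: by end_near. Qed.

(** The shift by 1 forces the value 1 at x = 0, so the limit is the indicator of the closed
    half-line. Without it the value at 0 is 0 and the limit is that of the open one. *)
Lemma ramp_cvg_le (x : R) : ramp (1 + n%:R * x) @[n --> \oo] --> ((0 <= x)%R%:R : R).
Proof.
have [x0|x0] := leP 0 x.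
  rewrite (_ : (fun n => _) = (fun=> 1)); first exact: cvg_cst.
  by apply/funext => n; rewrite ramp_ge1// lerDl mulr_ge0.
apply: cvg_near_cst; exists (Num.truncn (- x)^-1).+1 => // n /= nn.
rewrite ramp_le0//.
have : (- x)^-1 <= n%:R by rewrite ltW//; apply: lt_le_trans (truncnS_gt _) _; rewrite ler_nat.
by rewrite -[leLHS]mul1r ler_pdivrMr ?oppr_gt0//; lra.
Qed.

Lemma ramp_cvg_lt (x : R) : ramp (n%:R * x) @[n --> \oo] --> ((0 < x)%R%:R : R).
Proof.
have [x0|x0] := leP x 0.
  rewrite (_ : (fun n => _) = (fun=> 0)); first exact: cvg_cst.
  by apply/funext => n; rewrite ramp_le0// mulr_ge0_le0.
apply: cvg_near_cst; exists (Num.truncn x^-1).+1 => // n /= nn.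
rewrite ramp_ge1//.
have : x^-1 <= n%:R by rewrite ltW//; apply: lt_le_trans (truncnS_gt _) _; rewrite ler_nat.
by rewrite -[leLHS]mul1r ler_pdivrMr.
Qed.

End ramp.

Section closed_test.
Context (R : realType) (T k : nat) (pi : probability (borel (obsA R T k)) R).
Variables (f : obsA R T k -> R) (fn : nat -> obsA R T k -> R).
Hypothesis mfn : forall n, measurable_fun setT (fn n : borel (obsA R T k) -> R).
Hypothesis fn1 : forall n v, `|fn n v| <= 1.
Hypothesis fn_f : forall v, fn n v @[n --> \oo] --> f v.

Lemma measurable_covlat : measurable_fun setT (@covlat R T k).
Proof.
apply: (@borel_continuousT R _ (borel (obsA R T k)) (covA R T k) (@covlat R T k)) => O oO.
apply: borel_open; apply: open_comp => // x _; exact: covlat_continuous.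
Qed.

Let mf : measurable_fun setT (f : borel (obsA R T k) -> R).
Proof. by apply: (measurable_fun_cvg mfn) => v _; exact: fn_f. Qed.

Let f1 v : `|f v| <= 1.
Proof.
have h : `|fn n v| @[n --> \oo] --> `|f v| by apply: cvg_norm; exact: fn_f.
by apply: (ler_cvg_to h (cvg_cst (1 : R))); near=> n.
Unshelve. all: by end_near. Qed.

Let mcov (B : set (covA R T k)) : measurable (B : set (borel (covA R T k))) ->
  measurable (@covlat R T k @^-1` B : set (borel (obsA R T k))).
Proof. by move=> mB; rewrite -[X in measurable X]setTI; exact: measurable_covlat. Qed.

Let RV_cov : {mfun borel (obsA R T k) >-> borel (covA R T k)} :=
  mfun_Sub (mem_set measurable_covlat).

Hypothesis closed_ge0 : forall (B : set (covA R T k)) n, closed B ->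
  0 <= \int[pi]_v (bump B n (covlat v) * fn n v).

Let mbump (B : set (covA R T k)) n :
  measurable_fun setT (fun v : borel (obsA R T k) => bump B n (covlat v)).
Proof.
apply: (@borel_continuous R (obsA R T k) (fun v => bump B n (v.1.2, v.2))).
move=> v; apply: (@continuous_comp _ (covA R T k) _ (fun v : obsA R T k => (v.1.2, v.2)) (bump B n)).
  exact: covlat_continuous.
exact: bump_continuous.
Qed.

(** Cutoff and test function converge pointwise along the same index n, the cutoff because B is
    closed; dominated convergence applies with the bound 1. *)
Let ge0_closed (B : set (covA R T k)) : closed B ->
  0 <= \int[pi]_v (\1_(@covlat R T k @^-1` B) v * f v).
Proof.
move=> cB.
pose g n (v : borel (obsA R T k)) := bump B n (covlat v) * fn n v.
have mg n : measurable_fun setT (g n) by exact: measurable_funM.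
have mcB := mcov (borel_closed cB).
have mlim : measurable_fun setT (fun v : borel (obsA R T k) => \1_(@covlat R T k @^-1` B) v * f v).
  by apply: measurable_funM => //; exact: measurable_indic.
have i1 : pi.-integrable setT (EFin \o (fun=> 1 : R)).
  exact: (bfun_integrable pi measurableT (measurable_cst _) (bfun_cst _ _)).
have h1 n : measurable_fun setT (EFin \o g n) by exact/measurable_EFinP.
have h2 := (measurable_EFinP _ _).2 mlim.
have h3 : {ae pi, forall v, setT v -> (EFin \o g n) v @[n --> \oo] -->
    (EFin \o (fun v => \1_(@covlat R T k @^-1` B) v * f v)) v}.
  apply: aeW => v _; apply: cvg_EFin; first exact: nearW.
  have -> : \1_(@covlat R T k @^-1` B) v = \1_B (covlat v) :> R.
    by rewrite !indicE; congr (nat_of_bool _)%:R; apply/idP/idP; rewrite !inE.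
  have h : g n v @[n --> \oo] --> (\1_B (covlat v) * f v : R).
    by apply: cvgM; [exact: bump_cvg|exact: fn_f].
  exact: h.
have h4 : {ae pi, forall v n, setT v -> (`|(EFin \o g n) v| <= (EFin \o (fun=> 1%R : R)) v)%E}.
  apply: aeW => v n _; rewrite /= lee_fin /g normrM.
  have /andP[b0 b1] := bump01 B n (covlat v).
  by rewrite ger0_norm// -[leRHS]mulr1; exact: ler_pM.
have [_ _ dc] := dominated_convergence measurableT h1 h2 h3 i1 h4.
have ig n : pi.-integrable setT (EFin \o g n).
  apply: (bfun_integrable pi measurableT (mg n)); apply: bfunM; last by exists 1.
  by exists 1 => v; have /andP[b0 b1] := bump01 B n (covlat v); rewrite ger0_norm.
rewrite -lee_fin /Rintegral fineK; last first.
  apply: integrable_fin_num => //; apply: (bfun_integrable pi measurableT mlim).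
  by apply: bfunM; [exact: bfun_bool|exists 1].
rewrite -(cvg_lim _ dc)//; apply: lime_ge; first by apply/cvg_ex; eexists; exact: dc.
apply: nearW => n; have := closed_ge0 n cB.
rewrite -lee_fin /Rintegral fineK; first exact.
exact: (integrable_fin_num measurableT (ig n)).
Qed.

(** A closed F inside B misses mass at most e under the law of (X, A), and since |f| <= 1 the
    integral over the missing part is at most e in absolute value. *)
Lemma test_ge0 (B : set (borel (covA R T k))) : measurable B ->
  0 <= \int[pi]_v (\1_(@covlat R T k @^-1` B) v * f v).
Proof.
move=> mB; apply/ler_addgt0Pr => e e0.
have [F [cF FB] BF] := @closed_inner_regular R (covA R T k) (distribution pi RV_cov) B mB e e0.
have mF : measurable (F : set (borel (covA R T k))) by exact: borel_closed.
have mBF : measurable (B `\` F) by exact: measurableD.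
have bf (A : set (borel (covA R T k))) : measurable A ->
    pi.-integrable setT (EFin \o (fun v => \1_(@covlat R T k @^-1` A) v * f v)).
  move=> mA; apply: (bfun_integrable pi measurableT).
    by apply: measurable_funM => //; apply: measurable_indic; exact: mcov.
  by apply: bfunM; [exact: bfun_bool|exists 1].
have iA (A : set (borel (covA R T k))) : measurable A ->
    pi.-integrable setT (EFin \o (\1_(@covlat R T k @^-1` A) : _ -> R)).
  move=> mA; apply: (bfun_integrable pi measurableT); last exact: bfun_bool.
  by apply: measurable_indic; exact: mcov.
have -> : \int[pi]_v (\1_(@covlat R T k @^-1` B) v * f v) =
    \int[pi]_v (\1_(@covlat R T k @^-1` F) v * f v) +
    \int[pi]_v (\1_(@covlat R T k @^-1` (B `\` F)) v * f v).
  rewrite -RintegralD//; [|exact: bf..]; apply: eq_Rintegral => v _.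
  rewrite -mulrDl !indicE; congr (_ * _); rewrite -natrD; congr (_%:R).
  have mE (A : set (covA R T k)) : (v \in @covlat R T k @^-1` A) = (covlat v \in A).
    by apply/idP/idP; rewrite !inE.
  rewrite !mE in_setD; have [Fv|nFv] := boolP (covlat v \in F); last by rewrite andbT.
  by rewrite andbF addn0 mem_set//; apply: FB; rewrite inE in Fv.
have F0 := ge0_closed cF.
have : `|\int[pi]_v (\1_(@covlat R T k @^-1` (B `\` F)) v * f v)| <= e.
  apply: (le_trans (le_normr_Rintegral _ _)) => //; first exact: bf.
  apply: (@le_trans _ _ (\int[pi]_v \1_(@covlat R T k @^-1` (B `\` F)) v)).
    apply: le_Rintegral => //; [|exact: iA|].
      by have := integrable_norm (bf _ mBF).
    move=> v _; rewrite normrM -[leRHS]mulr1; apply: ler_pM => //.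
    by rewrite ger0_norm.
  rewrite /Rintegral integral_indic//; last exact: mcov.
  rewrite setIT -lee_fin fineK//.
  by apply: fin_num_measure; exact: mcov.
rewrite ler_norml => /andP[]; lra.
Qed.

End closed_test.

(** * Sufficiency *)

Section sufficiency.
Context (R : realType) (T k : nat).
Variables (th : param R k) (P : probability (borel (obs R T k)) R) (tau : R).
Hypotheses (hT : (1 <= T)%N) (cP : compact (msupport P)) (htau : 0 < tau < 1).

(** Both smoothed coefficients lie above the discontinuous ones, on which the sign of [L] is known,
    and are Lipschitz in a with constant n. *)
Let smooth_le n l t (v : obsA R T k) : R :=
  ramp (1 + n%:R * (v.2 - Z th l t v.1)) - q tau l.

Let smooth_lt n l t (v : obsA R T k) : R :=
  q tau l - ramp (n%:R * (v.2 - Z th l t v.1)).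

Let Zc l t : continuous (fun v : obsA R T k => v.2 - Z th l t v.1).
Proof. by move=> v; apply: cvgB; [exact: cvg_snd|exact: Z_fst_continuous]. Qed.

Let ramp_comp (g : obsA R T k -> R) : continuous g -> continuous (fun v => ramp (g v)).
Proof.
move=> cg v; apply: (@continuous_comp _ _ _ g (@ramp R)); first exact: cg.
exact: ramp_continuous.
Qed.

Let smooth_le_continuous n l t : continuous (smooth_le n l t).
Proof.
move=> v; apply: cvgB; last exact: cvg_cst.
apply: ramp_comp => {}v; apply: cvgD; first exact: cvg_cst.
by apply: cvgM; [exact: cvg_cst|exact: Zc].
Qed.

Let smooth_lt_continuous n l t : continuous (smooth_lt n l t).
Proof.
move=> v; apply: cvgB; first exact: cvg_cst.
by apply: ramp_comp => {}v; apply: cvgM; [exact: cvg_cst|exact: Zc].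
Qed.

Let smooth_le1 n l t v : `|smooth_le n l t v| <= 1.
Proof.
have /andP[q0 q1] := q_bounds htau l; rewrite /smooth_le.
by have /andP[r0 r1] := ramp01 (1 + n%:R * (v.2 - Z th l t v.1)); rewrite ler_norml; lra.
Qed.

Let smooth_lt1 n l t v : `|smooth_lt n l t v| <= 1.
Proof.
have /andP[q0 q1] := q_bounds htau l; rewrite /smooth_lt.
by have /andP[r0 r1] := ramp01 (n%:R * (v.2 - Z th l t v.1)); rewrite ler_norml; lra.
Qed.

Let smooth_le_lip n l t w a b :
  `|smooth_le n l t (w, a) - smooth_le n l t (w, b)| <= n%:R * `|a - b|.
Proof.
rewrite /smooth_le/= opprB addrA subrK; apply: (le_trans (ramp_lip _ _)).
have -> : 1 + n%:R * (a - Z th l t w) - (1 + n%:R * (b - Z th l t w)) = n%:R * (a - b).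
  by ring.
by rewrite normrM ger0_norm.
Qed.

Let smooth_lt_lip n l t w a b :
  `|smooth_lt n l t (w, a) - smooth_lt n l t (w, b)| <= n%:R * `|a - b|.
Proof.
rewrite /smooth_lt/=.
have -> : q tau l - ramp (n%:R * (a - Z th l t w)) - (q tau l - ramp (n%:R * (b - Z th l t w)))
    = ramp (n%:R * (b - Z th l t w)) - ramp (n%:R * (a - Z th l t w)) by ring.
apply: (le_trans (ramp_lip _ _)).
have -> : n%:R * (b - Z th l t w) - n%:R * (a - Z th l t w) = n%:R * (b - a) by ring.
by rewrite normrM ger0_norm// distrC.
Qed.

Let test_lip (B : set (covA R T k)) n (g : obsA R T k -> R) :
  (forall v, `|g v| <= 1) ->
  (forall w a b, `|g (w, a) - g (w, b)| <= n%:R * `|a - b|) ->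
  forall w a b, `|bump B n (w.2, a) * g (w, a) - bump B n (w.2, b) * g (w, b)| <=
    (2 * n%:R) * `|a - b|.
Proof.
move=> g1 gl w a b.
have bl : `|bump B n (w.2, a) - bump B n (w.2, b)| <= n%:R * `|a - b|.
  apply: (le_trans (bump_lip _ _ _ _)); rewrite ler_wpM2l//.
  by rewrite prod_normE/= subrr normr0 max_r.
have /andP[b0 b1] := bump01 B n (w.2, b).
have -> : bump B n (w.2, a) * g (w, a) - bump B n (w.2, b) * g (w, b) =
  (bump B n (w.2, a) - bump B n (w.2, b)) * g (w, a) +
  bump B n (w.2, b) * (g (w, a) - g (w, b)) by ring.
apply: (le_trans (ler_normD _ _)); rewrite -mulrA mulr_natl mulr2n; apply: lerD.
  by rewrite normrM -[leRHS]mulr1; exact: ler_pM.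
by rewrite normrM ger0_norm// -[leRHS]mul1r; exact: ler_pM.
Qed.

Let bump_tame (B : set (covA R T k)) n : tame (bump B n).
Proof.
split; first exact: bump_continuous.
  by exists 1 => v; have /andP[b0 b1] := bump01 B n v; rewrite ger0_norm.
by move=> v; have /andP[] := bump01 B n v.
Qed.

Lemma law_of_multipliers :
  (forall lam, admissible th P lam -> (0 <= Psi tau P th lam)%E) ->
  exists pi : probability (borel (obsA R T k)) R,
    (forall B : set (borel (obs R T k)), measurable B ->
       pushforward pi (fst : borel (obsA R T k) -> borel (obs R T k)) B = P B) /\
    forall l t (B : set (borel (covA R T k))), measurable B ->
      0 <= \int[pi]_v (\1_(@covlat R T k @^-1` B) v *
             (\1_[set o : borel (obsA R T k) | Z th l t o.1 <= o.2] v - q tau l)) /\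
      0 <= \int[pi]_v (\1_(@covlat R T k @^-1` B) v *
             (q tau l - \1_[set o : borel (obsA R T k) | Z th l t o.1 < o.2] v)).
Proof.
move=> H.
have [L [LD LZ L_le L_fst HL]] := dual_functional hT cP htau H.
have lohi : inf (Z_values th P) < sup (Z_values th P) + 1.
  by rewrite (le_lt_trans (K_theta_le th hT cP))// ltrDl.
have [pi0 [pi0f pi0E]] := representation lohi LD LZ L_le L_fst.
have mid : measurable_fun setT
    (idfun : (borel (obs R T k) * R)%type -> borel (obsA R T k)).
  exact: (@borel_prod R (obs R T k) (@separable_obs R T k)).
pose RV_id : {mfun (borel (obs R T k) * R)%type >-> borel (obsA R T k)} :=
  mfun_Sub (mem_set mid).
(* The law obtained on the product sigma-algebra is transported by the identity to the Borel sets of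
   the product topology. *)
pose pi : probability (borel (obsA R T k)) R := distribution pi0 RV_id.
have piE (phi : obsA R T k -> R) C : continuous phi -> bfun phi ->
    (forall w a b, `|phi (w, a) - phi (w, b)| <= C * `|a - b|) ->
    \int[pi]_v phi v = L phi.
  move=> cphi bphi lphi.
  have mphi : measurable_fun setT (phi : borel (obsA R T k) -> R).
    exact: borel_continuous.
  have mphi0 : measurable_fun setT (phi : (borel (obs R T k) * R)%type -> R).
    exact: (measurableT_comp mphi mid).
  rewrite -(pi0E phi C mphi0 bphi lphi); congr fine.
  apply: (integral_pushforward mid (f := EFin \o phi)) => //.
    exact/measurable_EFinP.
  exact: (bfun_integrable pi0 measurableT mphi0 bphi).
exists pi; split=> [B mB|l t B mB].
  have <- := pi0f B mB; congr (pi0 _).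
  by apply/seteqP; split=> v //= [].
(* The discontinuous f is evaluated under [L] only; monotonicity raises it to the Lipschitz g, for
   which [L] and [pi] agree. *)
have test_L (g f : obsA R T k -> R) n (F : set (covA R T k)) :
    continuous g -> (forall v, `|g v| <= 1) ->
    (forall w a b, `|g (w, a) - g (w, b)| <= n%:R * `|a - b|) ->
    (forall v, f v <= g v) -> bfun f ->
    0 <= L (fun v => bump F n (v.1.2, v.2) * f v) ->
    0 <= \int[pi]_v (bump F n (covlat v) * g v).
  move=> cg g1 lg fg bf /le_trans; apply.
  have [cb bb b0] := bump_tame F n.
  have bb' : bfun (fun v : obsA R T k => bump F n (v.1.2, v.2)).
    exact: (bfun_comp (fun v : obsA R T k => (v.1.2, v.2)) bb).
  have bg : bfun g by exists 1.
  rewrite (piE _ (2 * n%:R)).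
  - apply: L_le; [exact: (bfunM bb' bf)|exact: (bfunM bb' bg)|].
    by move=> w a _ /=; apply: ler_wpM2l => //; exact: b0.
  - move=> v; apply: cvgM; last exact: cg.
    apply: (@continuous_comp _ (covA R T k) _ (fun v : obsA R T k => (v.1.2, v.2)) (bump F n)).
      exact: covlat_continuous.
    exact: bump_continuous.
  - exact: (bfunM bb' bg).
  - by move=> w a b; exact: (test_lip F g1 lg).
have bf_le : bfun (fun v : obsA R T k => (Z th l t v.1 <= v.2)%R%:R - q tau l).
  exact: (bfunD (bfun_bool _ _) (bfun_cst _ _)).
have bf_lt : bfun (fun v : obsA R T k => q tau l - (Z th l t v.1 < v.2)%R%:R).
  exists 2 => v; have /andP[q0 q1] := q_bounds htau l.
  by rewrite ler_norml; case: (Z _ _ _ _ < _) => /=; lra.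
have z0 : tame (fun=> 0 : R) := @tame0 R T k.
split.
  apply: (@test_ge0 R T k pi _ (fun n => smooth_le n l t)) => //.
  - by move=> n; exact: borel_continuous.
  - move=> v; apply: cvgB; last exact: cvg_cst.
    by rewrite indic_bool -subr_ge0; exact: ramp_cvg_le.
  move=> F n _.
  have fg (v : obsA R T k) : (Z th l t v.1 <= v.2)%R%:R - q tau l <= smooth_le n l t v.
    rewrite /smooth_le lerD2r; have [Zv|_] := leP (Z th l t v.1) v.2.
      by rewrite ramp_ge1// lerDl mulr_ge0// subr_ge0.
    by have /andP[] := ramp01 (1 + n%:R * (v.2 - Z th l t v.1)).
  apply: (test_L _ _ n F (@smooth_le_continuous n l t) (@smooth_le1 n l t)
    (@smooth_le_lip n l t) fg bf_le).
  have := HL l t _ _ (bump_tame F n) z0; congr (0 <= L _); apply/funext => v.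
  by rewrite mul0r addr0.
apply: (@test_ge0 R T k pi _ (fun n => smooth_lt n l t)) => //.
- by move=> n; exact: borel_continuous.
- move=> v; apply: cvgB; first exact: cvg_cst.
  by rewrite indic_bool -subr_gt0; exact: ramp_cvg_lt.
move=> F n _.
have fg (v : obsA R T k) : q tau l - (Z th l t v.1 < v.2)%R%:R <= smooth_lt n l t v.
  rewrite /smooth_lt lerD2l lerN2; have [_|Zv] := ltP (Z th l t v.1) v.2.
    by have /andP[] := ramp01 (n%:R * (v.2 - Z th l t v.1)).
  by rewrite ramp_le0// mulr_ge0_le0// subr_le0.
apply: (test_L _ _ n F (@smooth_lt_continuous n l t) (@smooth_lt1 n l t)
  (@smooth_lt_lip n l t) fg bf_lt).
have := HL l t _ _ z0 (bump_tame F n); congr (0 <= L _); apply/funext => v.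
by rewrite mul0r add0r.
Qed.

Lemma le_event_measurable l t :
  measurable [set o : borel (obsA R T k) | Z th l t o.1 <= o.2].
Proof.
have -> : [set o : borel (obsA R T k) | Z th l t o.1 <= o.2] =
    (fun v : obsA R T k => v.2 - Z th l t v.1) @^-1` `[0, +oo[%classic.
  by apply/seteqP; split=> v /=; rewrite in_itv/= andbT subr_ge0.
rewrite -[X in measurable X]setTI.
exact: (@borel_continuous R (obsA R T k) _ (@Zc l t) measurableT _ (measurable_itv _)).
Qed.

Lemma lt_event_measurable l t :
  measurable [set o : borel (obsA R T k) | Z th l t o.1 < o.2].
Proof.
have -> : [set o : borel (obsA R T k) | Z th l t o.1 < o.2] =
    (fun v : obsA R T k => v.2 - Z th l t v.1) @^-1` `]0, +oo[%classic.
  by apply/seteqP; split=> v /=; rewrite in_itv/= andbT subr_gt0.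
rewrite -[X in measurable X]setTI.
exact: (@borel_continuous R (obsA R T k) _ (@Zc l t) measurableT _ (measurable_itv _)).
Qed.

Theorem Theta_I_of_multipliers : 0 < th.2 ->
  (forall lam, admissible th P lam -> (0 <= Psi tau P th lam)%E) -> Theta_I tau P th.
Proof.
move=> r0 H; split=> //; have [pi [pif piE]] := law_of_multipliers H.
exists pi; split=> //.
have mV := @measurable_covlat R T k.
have mVB (B : set (borel (covA R T k))) : measurable B ->
    measurable (@covlat R T k @^-1` B : set (borel (obsA R T k))).
  by move=> mB; rewrite -[X in measurable X]setTI; exact: mV.
have hle : forall lt : 'I_2 * 'I_T, exists g : borel (obsA R T k) -> R,
    is_cond_prob pi (@covlat R T k) [set o | Z th lt.1 lt.2 o.1 <= o.2] g /\
    {ae pi, forall o, q tau lt.1 <= g o}.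
  move=> [l t] /=; have mE := le_event_measurable l t.
  have [g [cg gq]] := cond_prob_exists pi mV mE; exists g; split=> //.
  apply: (gq _).1 => B mB; have [+ _] := piE l t B mB.
  by rewrite Rint_indic_sub ?subr_ge0//; exact: mVB.
have hlt : forall lt : 'I_2 * 'I_T, exists g : borel (obsA R T k) -> R,
    is_cond_prob pi (@covlat R T k) [set o | Z th lt.1 lt.2 o.1 < o.2] g /\
    {ae pi, forall o, g o <= q tau lt.1}.
  move=> [l t] /=; have mE := lt_event_measurable l t.
  have [g [cg gq]] := cond_prob_exists pi mV mE; exists g; split=> //.
  apply: (gq _).2 => B mB; have [_] := piE l t B mB.
  have -> : \int[pi]_v (\1_(@covlat R T k @^-1` B) v *
      (q tau l - \1_[set o : borel (obsA R T k) | Z th l t o.1 < o.2] v)) =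
    - \int[pi]_v (\1_(@covlat R T k @^-1` B) v *
      (\1_[set o : borel (obsA R T k) | Z th l t o.1 < o.2] v - q tau l)).
    rewrite -mulN1r -RintegralZl//; last first.
      apply: bmeas_integrable => //; split.
        apply: measurable_funM; first by apply: measurable_indic; exact: mVB.
        by apply: measurable_funB => //; exact: measurable_indic.
      apply: bfunM; first exact: bfun_bool.
      exact: (bfunD (bfun_bool _ _) (bfun_cst _ _)).
    by apply: eq_Rintegral => v _; ring.
  by rewrite Rint_indic_sub ?oppr_ge0 ?subr_le0//; exact: mVB.
have /choice[gle gleP] := hle; have /choice[glt gltP] := hlt.
exists (fun l t => gle (l, t)), (fun l t => glt (l, t)); split.
- by move=> l t; have [] := gleP (l, t).
- by move=> l t; have [] := gltP (l, t).
have h1 : {ae pi, forall o, forall lt : 'I_2 * 'I_T, q tau lt.1 <= gle lt o}.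
  by apply: filter_forall => lt; have [] := gleP lt.
have h2 : {ae pi, forall o, forall lt : 'I_2 * 'I_T, glt lt o <= q tau lt.1}.
  by apply: filter_forall => lt; have [] := gltP lt.
(* There are finitely many pairs (l, t), so one null set serves all the bounds. *)
near=> o => l t; split.
  have : forall lt : 'I_2 * 'I_T, q tau lt.1 <= gle lt o by near: o.
  by move=> /(_ (l, t)).
have : forall lt : 'I_2 * 'I_T, glt lt o <= q tau lt.1 by near: o.
by move=> /(_ (l, t)).
Unshelve. all: by end_near. Qed.

End sufficiency.

(** * Necessity *)

Lemma ae_le_integral (R : realType) d (T : measurableType d) (mu : {measure set T -> \bar R})
    (D : set T) (f g : T -> R) : measurable D ->
  mu.-integrable setT (EFin \o f) -> mu.-integrable setT (EFin \o g) ->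
  {ae mu, forall x, f x <= g x} ->
  (\int[mu]_(x in D) (f x)%:E <= \int[mu]_(x in D) (g x)%:E)%E.
Proof.
move=> mD intf intg [N [mN N0 subN]].
have iD h : mu.-integrable setT (EFin \o h) -> mu.-integrable D (EFin \o h).
  by move=> ih; exact: integrableS ih.
have mDN : measurable (D `\` N) by exact: measurableD.
rewrite [leLHS](negligible_integral mN mD (iD _ intf) N0).
rewrite [leRHS](negligible_integral mN mD (iD _ intg) N0).
apply: le_integral => //.
- exact: integrableS intf.
- exact: integrableS intg.
- move=> x; rewrite inE => -[_ Nx]; rewrite lee_fin.
  by have := contra_not (subN x) Nx; apply: contrapT.
Qed.

Lemma borel_within_continuous (R : realType) (V : normedModType R) (D : set V)
    (f : V -> R) : closed D -> {within D, continuous f} ->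
  measurable_fun (D : set (borel V)) (f : borel V -> R).
Proof.
move=> cD cf; apply: (measurability _ (RGenCInfty.measurableE R)).
move=> _ [_ [c ->] <-].
have -> : D `&` f @^-1` `[c, +oo[%classic = [set v | D v /\ c <= f v].
  by apply/seteqP; split=> w /=; rewrite in_itv/= andbT.
apply: borel_closed; apply: usc_on_closed => // v Dv e e0.
have /subspace_continuousP/(_ _ Dv)/cvgrPdist_le/(_ e e0) h := cf.
near=> v'; have h' : D v' -> `|f v - f v'| <= e by near: v'.
by move=> Dv'; have := h' Dv'; rewrite ler_norml; lra.
Unshelve. all: by end_near.
Qed.

Lemma Rintegral_sum_ge0 (R : realType) d (T : measurableType d) (mu : probability T R)
    (I : Type) (s : seq I) (F : I -> T -> R) :
  (forall i, bmeas (F i) /\ 0 <= \int[mu]_x F i x) ->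
  bmeas (fun x => \sum_(i <- s) F i x) /\ 0 <= \int[mu]_x (\sum_(i <- s) F i x).
Proof.
move=> HF; elim: s => [|i s [[m1 b1] ih]].
  rewrite (_ : (fun x => _) = fun=> 0); last by apply/funext => x; rewrite big_nil.
  split; first by split; [exact: measurable_cst|exact: bfun_cst].
  by rewrite /Rintegral integral0.
have [[m2 b2] h2] := HF i.
rewrite (_ : (fun x => _) = F i \+ (fun x => \sum_(i <- s) F i x)); last first.
  by apply/funext => x; rewrite big_cons.
split; first by split; [exact: measurable_funD|exact: bfunD].
rewrite RintegralD//; [exact: addr_ge0| |]; exact: bfun_integrable.
Qed.

Section necessity.
Context (R : realType) (T k : nat).
Variables (th : param R k) (P : probability (borel (obs R T k)) R) (tau : R).
Hypotheses (hT : (1 <= T)%N) (cP : compact (msupport P)) (htau : 0 < tau < 1).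
Variable pi : probability (borel (obsA R T k)) R.
Hypothesis pif : forall B : set (borel (obs R T k)), measurable B ->
  pushforward pi (fst : borel (obsA R T k) -> borel (obs R T k)) B = P B.
Variables p_le p_lt : 'I_2 -> 'I_T -> borel (obsA R T k) -> R.
Hypothesis cle : forall l t, is_cond_prob pi (@covlat R T k)
  [set o | Z th l t o.1 <= o.2] (p_le l t).
Hypothesis clt : forall l t, is_cond_prob pi (@covlat R T k)
  [set o | Z th l t o.1 < o.2] (p_lt l t).
Hypothesis aep : {ae pi, forall o, forall l t,
  q tau l <= p_le l t o /\ p_lt l t o <= q tau l}.

Local Notation lo := (inf (Z_values th P)).
Local Notation hi := (sup (Z_values th P)).
Local Notation Vc := (@covlat R T k).
Local Notation Ele l t := [set o : borel (obsA R T k) | Z th l t o.1 <= o.2].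
Local Notation Elt l t := [set o : borel (obsA R T k) | Z th l t o.1 < o.2].

Let mVB (B : set (borel (covA R T k))) : measurable B ->
  measurable (Vc @^-1` B : set (borel (obsA R T k))).
Proof. by move=> mB; rewrite -[X in measurable X]setTI; exact: (@measurable_covlat R T k). Qed.

Let cint c : pi.-integrable setT (EFin \o (fun=> c : R)).
Proof. exact: (bfun_integrable pi measurableT (measurable_cst _) (bfun_cst _ _)). Qed.

Let ccst c (G : set (borel (obsA R T k))) : measurable G ->
  (\int[pi]_(x in G) c%:E = (c * fine (pi G))%:E)%E.
Proof.
move=> mG; transitivity (c%:E * pi G)%E; first exact: (integral_cst pi mG c%:E).
by rewrite EFinM fineK//; exact: fin_num_measure.
Qed.

Let le_lower l t B : measurable B ->
  q tau l * fine (pi (Vc @^-1` B)) <= fine (pi (Ele l t `&` Vc @^-1` B)).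
Proof.
move=> mB; have [_ ig gE] := cle l t.
have GB : g_sigma_algebra_preimage Vc (Vc @^-1` B) by exists B => //; rewrite setTI.
rewrite -lee_fin -(ccst _ (mVB mB)) fineK; last first.
  apply: fin_num_measure; apply: measurableI; last exact: mVB.
  exact: le_event_measurable.
rewrite -(gE _ GB); apply: ae_le_integral => //; first exact: mVB.
by apply: filterS aep => o /(_ l t)[].
Qed.

Let lt_upper l t B : measurable B ->
  fine (pi (Elt l t `&` Vc @^-1` B)) <= q tau l * fine (pi (Vc @^-1` B)).
Proof.
move=> mB; have [_ ig gE] := clt l t.
have GB : g_sigma_algebra_preimage Vc (Vc @^-1` B) by exists B => //; rewrite setTI.
rewrite -lee_fin -(ccst _ (mVB mB)) fineK; last first.
  apply: fin_num_measure; apply: measurableI; last exact: mVB.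
  exact: lt_event_measurable.
rewrite -(gE _ GB); apply: ae_le_integral => //; first exact: mVB.
by apply: filterS aep => o /(_ l t)[].
Qed.

Let mfst : measurable_fun setT (fst : borel (obsA R T k) -> borel (obs R T k)).
Proof.
apply: (@borel_continuousT R _ (borel (obsA R T k)) (obs R T k) fst) => O oO.
by apply: borel_open; apply: open_comp => // x _; exact: cvg_fst.
Qed.

Let outside : set (borel (obsA R T k)) := [set v | ~ msupport P v.1].

Let m_outside : measurable outside.
Proof.
have [clW _] := msupport_obs P.
by have := mfst measurableT (measurableC (borel_closed clW)); rewrite setTI.
Qed.

Let outside0 : pi outside = 0%E.
Proof.
have [clW PW] := msupport_obs P.
have mW : measurable (msupport P : set (borel (obs R T k))) by exact: borel_closed.
transitivity (P (~` msupport P)); first by rewrite -pif//; exact: measurableC.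
have := probability_setC P mW; rewrite PW subee//.
Qed.

Let above : set (covA R T k) := [set c | hi < c.2].
Let below : set (covA R T k) := [set c | c.2 < lo].

Let m_above : measurable (above : set (borel (covA R T k))).
Proof.
apply: borel_open; rewrite (_ : above = snd @^-1` `]hi, +oo[%classic).
  by apply: open_comp => // x _; exact: cvg_snd.
by apply/seteqP; split=> c /=; rewrite in_itv/= andbT.
Qed.

Let m_below : measurable (below : set (borel (covA R T k))).
Proof.
apply: borel_open; rewrite (_ : below = snd @^-1` `]-oo, lo[%classic).
  by apply: open_comp => // x _; exact: cvg_snd.
by apply/seteqP; split=> c /=; rewrite in_itv.
Qed.

Let fine0 (A : set (borel (obsA R T k))) : measurable A -> fine (pi A) <= 0 -> pi A = 0%E.
Proof.
move=> mA; rewrite -lee_fin fineK; last exact: fin_num_measure.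
by move=> A0; apply/eqP; rewrite eq_le A0 measure_ge0.
Qed.

Let above0 : pi (Vc @^-1` above) = 0%E.
Proof.
pose t0 := Ordinal hT; have /andP[q0 q1] := q_bounds htau (ord0 : 'I_2).
have mA := mVB m_above; have mE := lt_event_measurable th ord0 t0.
apply: fine0 => //; have := lt_upper ord0 t0 m_above.
have h : fine (pi (Vc @^-1` above)) <= fine (pi (Elt ord0 t0 `&` Vc @^-1` above)).
  have mEA : measurable (Elt ord0 t0 `&` Vc @^-1` above) by exact: measurableI.
  apply: fine_le; [exact: fin_num_measure|exact: fin_num_measure|].
  apply: (@le_trans _ _ (pi ((Elt ord0 t0 `&` Vc @^-1` above) `|` outside))).
    apply: le_measure; rewrite ?inE//; first exact: measurableU.
    move=> v /= va; have [Wv|nWv] := pselect (msupport P v.1); [left|by right].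
    split=> //=; apply: le_lt_trans va.
    by have /andP[] := Z_bounds th cP ord0 t0 Wv.
  apply: (le_trans (measureU2 _ _ _)) => //.
  by rewrite -[leRHS]adde0; apply: leeD => //; rewrite le_eqVlt; apply/orP; left; apply/eqP.
have := fine_ge0 (measure_ge0 pi (Vc @^-1` above)); move: h.
(* The mass x of the event satisfies x <= y <= q x with q < 1, which leaves x <= 0. *)
move: (fine _) (fine _) => x y; nra.
Qed.

Let below0 : pi (Vc @^-1` below) = 0%E.
Proof.
pose t0 := Ordinal hT; have /andP[q0 q1] := q_bounds htau (ord0 : 'I_2).
have mA := mVB m_below; have mE := le_event_measurable th ord0 t0.
apply: fine0 => //; have := le_lower ord0 t0 m_below.
have -> : pi (Ele ord0 t0 `&` Vc @^-1` below) = 0%E.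
  have mEA : measurable (Ele ord0 t0 `&` Vc @^-1` below) by exact: measurableI.
  apply: (subset_measure0 mEA m_outside) => //.
  move=> v [/= Zv va] Wv; have /andP[lZ _] := Z_bounds th cP ord0 t0 Wv.
  by have := lt_le_trans va (le_trans lZ Zv); rewrite ltxx.
by rewrite /= pmulr_rle0.
Qed.

Let ae_inside : {ae pi, forall v, msupport P v.1 /\ K_theta th P v.2}.
Proof.
have mA := mVB m_above; have mB := mVB m_below.
have : pi.-negligible (outside `|` (Vc @^-1` above `|` Vc @^-1` below)).
  apply: negligibleU; first by exists outside; split.
  by apply: negligibleU; [exists (Vc @^-1` above)|exists (Vc @^-1` below)]; split.
apply: negligibleS => v /= /not_andP[nW|nK]; first by left.
right; apply: contrapT => /not_orP[/negP na /negP nb]; apply: nK.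
by rewrite /K_theta/= in_itv/= !leNgt nb.
Qed.

Let test (E : set (borel (obsA R T k))) (h : covA R T k -> R) :
  measurable E -> bmeas (h : borel (covA R T k) -> R) ->
  bmeas (fun v : borel (obsA R T k) => h (Vc v)) /\
  bmeas (fun v : borel (obsA R T k) => h (Vc v) * \1_E v : R).
Proof.
move=> mE [mh bh].
have m1 : measurable_fun setT (fun v : borel (obsA R T k) => h (Vc v)).
  exact: (measurableT_comp mh (@measurable_covlat R T k)).
have b1 : bfun (fun v : borel (obsA R T k) => h (Vc v)) by exact: (bfun_comp Vc bh).
split; split=> //; last by apply: bfunM => //; exact: bfun_bool.
by apply: measurable_funM => //; exact: measurable_indic.
Qed.

Let pos_linear_test (E : set (borel (obsA R T k))) : measurable E ->
  pos_linear (fun h : borel (covA R T k) -> R => \int[pi]_v (h (Vc v) * \1_E v)).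
Proof.
move=> mE; split=> [f g bf bg|a f bf|f g bf bg fg].
- rewrite -RintegralD//; [|exact: bmeas_integrable (test mE _).2..].
  by apply: eq_Rintegral => v _ /=; rewrite mulrDl.
- rewrite -RintegralZl//; last exact: bmeas_integrable (test mE _).2.
  by apply: eq_Rintegral => v _ /=; rewrite mulrA.
- apply: le_Rintegral => //; [exact: bmeas_integrable (test mE _).2..|].
  by move=> v _; rewrite ler_wpM2r.
Qed.

Let pos_linearZ (c : R) (I : (borel (covA R T k) -> R) -> R) : 0 <= c ->
  pos_linear I -> pos_linear (fun h => c * I h).
Proof.
move=> c0 [ID IZ Im]; split=> [f g bf bg|a f bf|f g bf bg fg].
- by rewrite ID// mulrDr.
- by rewrite IZ// mulrCA.
- by apply: ler_wpM2l => //; exact: Im.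
Qed.

Let indic_preimage (B : set (covA R T k)) v : \1_B (Vc v) = \1_(Vc @^-1` B) v :> R.
Proof. by rewrite !indicE; congr (nat_of_bool _)%:R; apply/idP/idP; rewrite !inE. Qed.

Let test_indic (E : set (borel (obsA R T k))) (B : set (borel (covA R T k))) :
  measurable E -> measurable B ->
  \int[pi]_v (\1_B (Vc v) * \1_E v) = fine (pi (E `&` Vc @^-1` B)).
Proof.
move=> mE mB; rewrite -(Rint_indicM pi (mVB mB) mE).
by apply: eq_Rintegral => v _; rewrite indic_preimage.
Qed.

(** The bound on events of (X, A) is an inequality between two positive linear functionals at
    indicators; [pos_linear_le] carries it to every nonnegative bounded measurable multiplier. *)
Let lower l t (h : covA R T k -> R) : bmeas (h : borel (covA R T k) -> R) ->
  (forall c, 0 <= h c) ->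
  bmeas (fun v : borel (obsA R T k) => h (Vc v) * ((Z th l t v.1 <= v.2)%R%:R - q tau l)) /\
  0 <= \int[pi]_v (h (Vc v) * ((Z th l t v.1 <= v.2)%R%:R - q tau l)).
Proof.
move=> bh h0; have /andP[q0 _] := q_bounds htau l.
have mE := le_event_measurable th l t.
have [[m1 b1] [m2 b2]] := test mE bh.
have [_ [m3 b3]] := test measurableT bh.
have E v : h (Vc v) * ((Z th l t v.1 <= v.2)%R%:R - q tau l) =
    h (Vc v) * \1_(Ele l t) v - q tau l * (h (Vc v) * \1_setT v).
  by rewrite indic_bool indicT mulr1 mulrBr [q _ _ * _]mulrC.
have m4 : bmeas (fun v : borel (obsA R T k) => q tau l * (h (Vc v) * \1_setT v)).
  by split; [exact: measurable_funM|apply: bfunM => //; exact: bfun_cst].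
split.
  rewrite (_ : (fun v => _) = (fun v => h (Vc v) * \1_(Ele l t) v) \-
    (fun v => q tau l * (h (Vc v) * \1_setT v))); last by apply/funext => v; exact: E.
  split; first by apply: measurable_funB => //; exact: m4.1.
  have [M hM] := b2; have [M' hM'] := m4.2; exists (M + M') => v.
  exact: le_trans (ler_normB _ _) (lerD (hM _) (hM' _)).
have -> : \int[pi]_v (h (Vc v) * ((Z th l t v.1 <= v.2)%R%:R - q tau l)) =
    \int[pi]_v (h (Vc v) * \1_(Ele l t) v - q tau l * (h (Vc v) * \1_setT v)).
  by apply: eq_Rintegral => v _; exact: E.
rewrite RintegralB//; [|exact: bmeas_integrable..].
rewrite RintegralZl//; try exact: bmeas_integrable.
rewrite subr_ge0.
apply: (pos_linear_le (pos_linearZ (ltW q0) (pos_linear_test measurableT))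
  (pos_linear_test mE)) => // B mB.
by rewrite !test_indic// setTI; exact: le_lower.
Qed.

Let upper l t (h : covA R T k -> R) : bmeas (h : borel (covA R T k) -> R) ->
  (forall c, 0 <= h c) ->
  bmeas (fun v : borel (obsA R T k) => h (Vc v) * (q tau l - (Z th l t v.1 < v.2)%R%:R)) /\
  0 <= \int[pi]_v (h (Vc v) * (q tau l - (Z th l t v.1 < v.2)%R%:R)).
Proof.
move=> bh h0; have /andP[q0 _] := q_bounds htau l.
have mE := lt_event_measurable th l t.
have [[m1 b1] [m2 b2]] := test mE bh.
have [_ [m3 b3]] := test measurableT bh.
have E v : h (Vc v) * (q tau l - (Z th l t v.1 < v.2)%R%:R) =
    q tau l * (h (Vc v) * \1_setT v) - h (Vc v) * \1_(Elt l t) v.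
  by rewrite indic_bool indicT mulr1 mulrBr [q _ _ * _]mulrC.
have m4 : bmeas (fun v : borel (obsA R T k) => q tau l * (h (Vc v) * \1_setT v)).
  by split; [exact: measurable_funM|apply: bfunM => //; exact: bfun_cst].
split.
  rewrite (_ : (fun v => _) = (fun v => q tau l * (h (Vc v) * \1_setT v)) \-
    (fun v => h (Vc v) * \1_(Elt l t) v)); last by apply/funext => v; exact: E.
  split; first by apply: measurable_funB => //; exact: m4.1.
  have [M hM] := b2; have [M' hM'] := m4.2; exists (M' + M) => v.
  exact: le_trans (ler_normB _ _) (lerD (hM' _) (hM _)).
have -> : \int[pi]_v (h (Vc v) * (q tau l - (Z th l t v.1 < v.2)%R%:R)) =
    \int[pi]_v (q tau l * (h (Vc v) * \1_setT v) - h (Vc v) * \1_(Elt l t) v).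
  by apply: eq_Rintegral => v _; exact: E.
rewrite RintegralB//; [|exact: bmeas_integrable..].
rewrite RintegralZl//; try exact: bmeas_integrable.
rewrite subr_ge0.
apply: (pos_linear_le (pos_linear_test mE)
  (pos_linearZ (ltW q0) (pos_linear_test measurableT))) => // B mB.
by rewrite !test_indic// setTI; exact: lt_upper.
Qed.

Lemma Psi_ge0 lam : admissible th P lam -> (0 <= Psi tau P th lam)%E.
Proof.
move=> alam; have [clW PW] := msupport_obs P.
have mW : measurable (msupport P : set (borel (obs R T k))) by exact: borel_closed.
pose XK := X_supp P `*` K_theta th P.
have clXK : closed XK.
  by apply: compact_closed; [exact: norm_hausdorff|exact: XK_compact].
(* Admissible multipliers are controlled on [XK] only. Extension by zero makes them bounded,
   nonnegative and Borel on the whole space, since [XK] is closed. *)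
have ext f : cont_nonneg XK f -> bmeas (f \_ XK : borel (covA R T k) -> R) /\
    forall c, 0 <= (f \_ XK) c.
  move=> cf; have [M M0 fM] := cont_nonneg_bounded cP cf; split; last first.
    move=> c; rewrite patchE; case: ifPn => //; rewrite inE => XKc.
    by have /andP[] := fM c XKc.
  split.
    have mf := @borel_within_continuous R (covA R T k) XK f clXK cf.1.
    have mXK : measurable (XK : set (borel (covA R T k))) by exact: borel_closed.
    exact: (measurable_restrictT (f : borel (covA R T k) -> R) mXK).1.
  exists M => c; rewrite patchE; case: ifPn => [|_]; last by rewrite normr0.
  by rewrite inE => XKc; have /andP[f0 f1] := fM c XKc; rewrite ger0_norm.
pose S (v : borel (obsA R T k)) : R := \sum_(l < 2) \sum_(t < T)
  ((lam_minus lam l t \_ XK) (Vc v) * ((Z th l t v.1 <= v.2)%R%:R - q tau l) +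
   (lam_plus lam l t \_ XK) (Vc v) * (q tau l - (Z th l t v.1 < v.2)%R%:R)).
have [bS S0] : bmeas S /\ 0 <= \int[pi]_v S v.
  apply: Rintegral_sum_ge0 => l; apply: Rintegral_sum_ge0 => t.
  have [lm lp] := alam l t; have [bm m0] := ext _ lm; have [bp p0] := ext _ lp.
  have [b1 i1] := lower l t bm m0; have [b2 i2] := upper l t bp p0.
  split.
    by split; [apply: measurable_funD; [exact: b1.1|exact: b2.1]|exact: (bfunD b1.2 b2.2)].
  by rewrite RintegralD//; [exact: addr_ge0|exact: bmeas_integrable..].
have mSup := S_sup_measurable hT cP htau alam.
have [M SM] := S_sup_bounded hT cP htau alam.
pose F := S_sup th P tau lam \_ (msupport P).
have mF : measurable_fun setT (F : borel (obs R T k) -> R).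
  exact: (measurable_restrictT (S_sup th P tau lam : borel (obs R T k) -> R) mW).1 mSup.
have bF : bfun F.
  exists `|M| => w; rewrite /F patchE; case: ifPn => [|_]; last by rewrite normr0.
  by rewrite inE => Ww; apply: (le_trans (SM w Ww)); exact: ler_norm.
have mFf : measurable_fun setT (fun v : borel (obsA R T k) => F v.1).
  exact: (measurableT_comp mF mfst).
have bFf : bfun (fun v : borel (obsA R T k) => F v.1) by exact: (bfun_comp fst bF).
have -> : Psi tau P th lam = (\int[pi]_v (F v.1)%:E)%E.
  rewrite /Psi integral_mkcond.
  transitivity (\int[P]_w (F w)%:E)%E.
    by apply: eq_integral => w _; rewrite /F !patchE; case: ifP.
  transitivity (\int[pushforward pi (fst : borel (obsA R T k) -> borel (obs R T k))]_w (F w)%:E)%E.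
    by apply: eq_measure_integral => A mA _; rewrite [RHS]pif.
  apply: (integral_pushforward mfst (f := EFin \o F)) => //.
    exact/measurable_EFinP.
  exact: (bfun_integrable pi measurableT mFf bFf).
have iF : pi.-integrable setT (EFin \o (fun v : borel (obsA R T k) => F v.1)).
  exact: (bfun_integrable pi measurableT mFf bFf).
have iS : pi.-integrable setT (EFin \o S) by exact: bmeas_integrable.
apply: (@le_trans _ _ (\int[pi]_v (S v)%:E)%E).
  by rewrite -[leRHS]fineK ?lee_fin//; exact: integrable_fin_num.
apply: ae_le_integral => //; have [N [mN N0 subN]] := ae_inside.
(* Almost surely (X, A) lies in [XK], where the zero extensions agree with the multipliers and the
   supremum dominates the value at A. *)
exists N; split=> // v nSF; apply: subN => -[Wv Kv]; apply: nSF.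
have FE : F v.1 = S_sup th P tau lam v.1 by rewrite /F patchE mem_set.
rewrite /= FE; apply: le_trans (S_sup_ge cP htau alam Wv Kv).
rewrite /S /S_theta; apply: ler_sum => l _; apply: ler_sum => t _.
have XKv : XK (Vc v) by split=> //; exists v.1.
by rewrite !patchE mem_set.
Qed.

End necessity.

(** * The characterization *)

Lemma Theta_I_iff (R : realType) (T k : nat) (th : param R k)
    (P : probability (borel (obs R T k)) R) (tau : R) :
  (1 <= T)%N -> compact (msupport P) -> 0 < tau < 1 -> 0 < th.2 ->
  Theta_I tau P th <->
  forall lam : multiplier R T k, admissible th P lam -> (0 <= Psi tau P th lam)%E.
Proof.
move=> hT cP htau r0; split; last exact: Theta_I_of_multipliers.
move=> [_ [pi [pif [p_le [p_lt [cle clt aep]]]]]] lam alam.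
exact: (Psi_ge0 hT cP htau pif cle clt aep alam).
Qed.

Unset Implicit Arguments.
Set Strict Implicit.

Theorem theorem8p8 (R : realType) (T k : nat) (hT : (1 <= T)%N) (hk : (1 <= k)%N)
    (tau : R) (htau : 0 < tau < 1) (htau2 : tau <> 1 / 2)
    (B0 : set 'cV[R]_k) (P : probability (borel (obs R T k)) R)
    (hP : compact (msupport P)) :
  [/\ forall th : param R k, 0 < th.2 ->
        (Theta_I tau P th <->
         forall lam : multiplier R T k, admissible th P lam ->
           (0 <= Psi tau P th lam)%E),
      forall th : param R k, 0 < th.2 -> ~ Theta_I tau P th ->
        exists2 lam : multiplier R T k, admissible th P lam &
          (Psi tau P th lam < 0)%E
    & Theta_pt tau B0 P =
      [set p : 'cV[R]_k * R | 0 < p.2 /\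
         exists2 b0, B0 b0 &
           forall lam : multiplier R T k, admissible (b0, p.1, p.2) P lam ->
             (0 <= Psi tau P (b0, p.1, p.2) lam)%E] ].
Proof.
have iff th := fun r0 => @Theta_I_iff R T k th P tau hT hP htau r0.
split=> [th r0|th r0 nTh|]; first exact: iff.
  apply: contrapT => nlam; apply: nTh; apply/(iff th r0) => lam alam.
  rewrite leNgt; apply/negP => Psi0; apply: nlam; by exists lam.
apply/seteqP; split=> [[b1 r] [b0 B0b0 Th]|[b1 r] [/= r0 [b0 B0b0 lamP]]].
  have r0 : 0 < r by case: Th.
  by split=> //; exists b0 => //; apply/iff.
by exists b0 => //; apply/iff.
Qed.
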